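(* Let $S\subset\mathbb R^2$ be a finite set of pairwise distinct points with $|S|$ even, and let $\mathcal M$ be a max-sum matching of $S$. Then $\mathcal M$ is an open Tverberg graph, i.e. the open discs with diameters $ab$, $ab\in\mathcal M$, have a common point.
   Context: The cost of a graph whose vertices are points of $\mathbb R^2$ is the sum of the Euclidean lengths $\|a-b\|$ over its edges $ab$. A max-sum matching of an even finite set $S\subset\mathbb R^2$ is a perfect matching with vertex set $S$ whose cost is maximum among all perfect matchings with vertex set $S$. For an edge $ab$, the open disc with diameter $ab$ is the open disc centered at $\frac{a+b}{2}$ with radius $\frac{\|a-b\|}{2}$. A graph is an open Tverberg graph if the open discs with diameters given by its edges have a nonempty common intersection. *)

(* Defs.v *)
From HB Require Import structures.
From mathcomp Require Import all_boot all_order all_algebra.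
From mathcomp Require Import finmap classical_sets reals.

Set Implicit Arguments.
Unset Strict Implicit.
Unset Printing Implicit Defensive.

Import Order.TTheory GRing.Theory Num.Theory.

Local Open Scope fset_scope.
Local Open Scope classical_set_scope.
Local Open Scope ring_scope.

Section MaxSumMatching.
Variable R : realType.
Local Notation point := 'rV[R]_2.
Implicit Types (a b x : point) (S : {fset point}) (E : {fset {fset point}}).

(* The library norm on row vectors is the sup norm, hence this definition. *)
Definition enorm x : R := Num.sqrt (\sum_(i < 2) x 0 i ^+ 2).

Definition edist a b : R := enorm (a - b).

Definition open_diametral_disc a b : set point :=
  [set x | edist x (2^-1 *: (a + b)) < edist a b / 2].

(* A graph is given by a finite vertex set S and a finite set E of edges, an
   edge ab being the two-element set [fset a; b]. *)
Definition graph_on S E : Prop :=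
  forall e, e \in E -> (e `<=` S)%fset /\ #|` e| = 2%N.

Definition perfect_matching S E : Prop :=
  graph_on S E /\ forall v, v \in S -> exists! e, e \in E /\ v \in e.

(* The endpoints of an edge are read off the enumeration of the set, whose
   order is immaterial by edge_lengthE below; 0 is an unused default. *)
Definition edge_length (e : {fset point}) : R :=
  edist (head 0 (enum_fset e)) (last 0 (enum_fset e)).

Definition cost E : R := \sum_(e <- E) edge_length e.

Definition max_sum_matching S E : Prop :=
  perfect_matching S E /\
  forall E', perfect_matching S E' -> cost E' <= cost E.

Definition open_tverberg_graph E : Prop :=
  exists x, forall a b, [fset a; b] \in E -> open_diametral_disc a b x.

Lemma edistC a b : edist a b = edist b a.
Proof.
rewrite /edist /enorm; congr Num.sqrt; apply: eq_bigr => i _.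
by rewrite -[a - b]opprB mxE sqrrN.
Qed.

Lemma edge_lengthE a b : a != b -> edge_length [fset a; b] = edist a b.
Proof.
move=> ab; rewrite /edge_length.
have : perm_eq (enum_fset [fset a; b]) [:: a; b].
  apply: uniq_perm; first exact: fset_uniq.
    by rewrite /= inE ab.
  by move=> x; rewrite -[LHS]/(x \in [fset a; b]) !inE.
move=> pab; have := perm_size pab.
case: (enum_fset _) pab => [|c [|d [|]]] //= pab _.
have := perm_mem pab c; have := perm_mem pab d.
have := perm_uniq pab; rewrite /= !inE !eqxx ab orbT /= andbT => cd.
move=> /esym/orP[] /eqP dE /esym/orP[] /eqP cE; move: cd; rewrite cE dE ?eqxx //.
by move=> _; rewrite edistC.
Qed.

End MaxSumMatching.

(* Main.v *)
(* Write [m_i] and [r_i] for the centers and radii of the discs, and let [o]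
   minimize the maximum [t] of [|o - m_i| / r_i]. If the open discs have no
   common point then [t >= 1], and the vectors [m_i - o] for which the maximum
   is attained lie in no open half-plane, so two of them are opposite or three
   of them turn once around [o].

   Two opposite edges [a b] and [c d] could be exchanged: the vectors [a - c]
   and [b - d] add up to twice the difference of the centers, whose length is
   [t (|a - b| + |c - d|)].

   For three edges, stretch each of them by the factor [t] about its center.
   This adds to each new vertex pair at most what it adds to the cost of the
   old pairs, so it suffices to beat the stretched edges, whose circles pass
   through [o]. Give an endpoint [p] of a stretched edge of length [h] the
   weight [|p - o|^2 / h]; the two weights of an edge add up to [h]. Two
   endpoints of different edges are at distance at least the sum of their
   weights as soon as an angle condition ([facing]) holds, and comparing angles
   always produces a perfect matching of such pairs, one of them strict. *)
From mathcomp Require Import all_boot all_order all_algebra.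
From mathcomp Require Import finmap classical_sets reals.
From mathcomp Require Import boolp topology normedtype realfun derive trigo.
From mathcomp Require Import ring lra.
Require Import Defs.

Set Implicit Arguments.
Unset Strict Implicit.
Unset Printing Implicit Defensive.

Import Order.TTheory GRing.Theory Num.Theory.
Import numFieldNormedType.Exports.

Local Open Scope fset_scope.
Local Open Scope ring_scope.

(** * Perfect matchings as lists of pairs *)

Section Pairings.
Variable R : realType.
Local Notation point := 'rV[R]_2.
Implicit Types (s : seq (point * point)) (S : {fset point}).

Definition pairing_cost s : R := \sum_(p <- s) edist p.1 p.2.

Definition vertices s : seq point := flatten [seq [:: p.1; p.2] | p <- s].

(** Competitors are compared through the list of their vertices, so an exchange is checked on the
    few pairs it touches. *)
Definition max_pairing s : Prop :=
  forall s', perm_eq (vertices s') (vertices s) ->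
    pairing_cost s' <= pairing_cost s.

Lemma vertices_cat s1 s2 : vertices (s1 ++ s2) = vertices s1 ++ vertices s2.
Proof. by rewrite /vertices map_cat flatten_cat. Qed.

Lemma pairing_cost_cat s1 s2 :
  pairing_cost (s1 ++ s2) = pairing_cost s1 + pairing_cost s2.
Proof. by rewrite /pairing_cost big_cat. Qed.

Lemma perm_vertices s1 s2 :
  perm_eq s1 s2 -> perm_eq (vertices s1) (vertices s2).
Proof. by move=> s12; apply/perm_flatten/perm_map. Qed.

Lemma max_pairing_perm s1 s2 :
  perm_eq (vertices s1) (vertices s2) -> pairing_cost s1 = pairing_cost s2 ->
  max_pairing s1 -> max_pairing s2.
Proof.
move=> s12 c12 max1 s' s'2; rewrite -c12; apply: max1.
by rewrite (perm_trans s'2)// perm_sym.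
Qed.

Lemma max_pairing_catl s1 s2 : max_pairing (s1 ++ s2) -> max_pairing s1.
Proof.
move=> max12 s' s'1; have := max12 (s' ++ s2).
by rewrite !vertices_cat !pairing_cost_cat perm_cat2r lerD2r; apply.
Qed.

(** An improvement of a few pairs, completed by the untouched ones, would improve the whole list.
    This reduces the argument to two or three edges. *)
Lemma max_pairing_sub s1 s :
  uniq s1 -> uniq s -> {subset s1 <= s} -> max_pairing s -> max_pairing s1.
Proof.
move=> us1 us s1s maxs.
apply: (@max_pairing_catl _ [seq p <- s | p \notin s1]).
have perm_s : perm_eq s (s1 ++ [seq p <- s | p \notin s1]).
  rewrite uniq_perm// ?cat_uniq ?us1 ?filter_uniq ?andbT//=.
    by apply/hasPn => p; rewrite mem_filter => /andP[].
  move=> p; rewrite mem_cat mem_filter.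
  by case: (boolP (p \in s1)) => //= /s1s ->.
by apply: max_pairing_perm maxs; [exact: perm_vertices|exact: perm_big].
Qed.

Lemma mem_vertices s p :
  p \in s -> (p.1 \in vertices s) * (p.2 \in vertices s).
Proof.
move=> ps; have sub x : x \in [:: p.1; p.2] -> x \in vertices s.
  by move=> xp; apply/flatten_mapP; exists p.
by rewrite !sub ?inE ?eqxx ?orbT.
Qed.

Lemma uniq_vertices_pair s p : uniq (vertices s) -> p \in s -> p.1 != p.2.
Proof.
move=> us ps; move: us; have := perm_vertices (perm_to_rem ps).
move=> /perm_uniq ->; rewrite /= inE negb_or; by case/andP => /andP[].
Qed.

Lemma uniq_vertices_uniq s : uniq (vertices s) -> uniq s.
Proof.
elim: s => //= p s IHs; rewrite !inE !negb_or => /and3P[/andP[_ ps] _ /IHs ->].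
by rewrite andbT; apply/negP => /mem_vertices; rewrite (negPf ps) => -[].
Qed.

Lemma vertices_disjoint s p q x : uniq (vertices s) -> p \in s -> q \in s ->
  x \in [:: p.1; p.2] -> x \in [:: q.1; q.2] -> p = q.
Proof.
move=> us ps qs xp xq; apply/eqP; apply: contraT => pq.
move: us; have := perm_vertices (perm_to_rem ps) => /perm_uniq ->.
rewrite -cat1s vertices_cat cat_uniq => /and3P[_ /hasP nhas _].
case: nhas; exists x; last exact: xp.
apply/flatten_mapP; exists q => //.
by have := perm_mem (perm_to_rem ps) q; rewrite qs inE eq_sym (negPf pq) => /esym.
Qed.

(** * Passage between edge sets and lists of pairs *)

Definition pairing_edges s : {fset {fset point}} :=
  [fset [fset p.1; p.2] | p in s].

Lemma mem_edge (a b x : point) : (x \in [fset a; b]) = (x \in [:: a; b]).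
Proof. by rewrite !inE. Qed.

Lemma pairing_edgesP s e :
  reflect (exists2 p, p \in s & e = [fset p.1; p.2]) (e \in pairing_edges s).
Proof.
by apply: (iffP (imfsetP _ _ _ _)) => -[p /= ps ->]; exists p.
Qed.

Lemma perfect_matching_pairing S s : uniq (vertices s) -> S =i vertices s ->
  perfect_matching S (pairing_edges s).
Proof.
move=> us Ss; split.
  move=> e /pairing_edgesP[p ps ->]; split.
    apply/fsubsetP => x; rewrite !inE Ss => /orP[] /eqP ->;
    by rewrite (mem_vertices ps).
  by rewrite cardfs2 (uniq_vertices_pair us ps).
move=> v; rewrite Ss => /flatten_mapP[p ps vp].
exists [fset p.1; p.2]; split.
  by split; [apply/pairing_edgesP; exists p|rewrite mem_edge].
move=> e [/pairing_edgesP[q qs ->]]; rewrite mem_edge => vq.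
by rewrite (vertices_disjoint us ps qs vp vq).
Qed.

Lemma cost_pairing s :
  uniq (vertices s) -> cost (pairing_edges s) = pairing_cost s.
Proof.
move=> us; rewrite /cost.
have inj : {in s &, injective (fun p : point * point => [fset p.1; p.2])}.
  move=> p q ps qs pq; apply: (vertices_disjoint (x := p.1) us ps qs).
    by rewrite inE eqxx.
  by rewrite -mem_edge -pq mem_edge inE eqxx.
have perm_edges : perm_eq (pairing_edges s) [seq [fset p.1; p.2] | p <- s].
  apply: uniq_perm; first exact: fset_uniq.
    by rewrite map_inj_in_uniq// uniq_vertices_uniq.
  move=> e; apply/pairing_edgesP/mapP => -[p ps ->]; by exists p.
rewrite (perm_big _ perm_edges) big_map /= /pairing_cost.
rewrite big_seq [RHS]big_seq; apply: eq_bigr => p ps.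
by rewrite edge_lengthE// (uniq_vertices_pair us ps).
Qed.

Lemma cardfs2_edge (e : {fset point}) : #|` e| = 2%N ->
  exists2 p : point * point, p.1 != p.2 & e = [fset p.1; p.2].
Proof.
move=> e2; have [x xe] : exists x, x \in e by apply/fset0Pn; rewrite -cardfs_gt0 e2.
have : #|` e `\ x| = 1%N by have := cardfsD1 x e; rewrite xe e2; case.
move=> /eqP/cardfs1P[y exy]; exists (x, y) => /=.
  have := fset11 y; rewrite -exy !inE => /andP[yx _]; by rewrite eq_sym.
by rewrite -exy fsetD1K.
Qed.

Lemma perfect_matching_exists_pairing S M : perfect_matching S M ->
  exists s, [/\ uniq (vertices s), S =i vertices s & M = pairing_edges s].
Proof.
move=> [graphM matchM].
suff [s us Ms] : exists2 s, uniq (vertices s) & M = pairing_edges s.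
  exists s; split => // v; apply/idP/idP => [/matchM[e [[]]]|].
    rewrite Ms => /pairing_edgesP[p ps ->]; rewrite mem_edge => vp _.
    by apply/flatten_mapP; exists p.
  move=> /flatten_mapP[p ps vp].
  have /graphM[/fsubsetP + _] : [fset p.1; p.2] \in M.
    by rewrite Ms; apply/pairing_edgesP; exists p.
  by apply; rewrite mem_edge.
have disjM e f v : e \in M -> f \in M -> v \in e -> v \in f -> e = f.
  move=> eM fM ve vf; have [/fsubsetP/(_ _ ve) vS _] := graphM _ eM.
  by have [g [_ gP]] := matchM _ vS; rewrite -(gP e)// -(gP f).
have [s us Ms] : exists2 s, uniq (vertices s) &
    enum_fset M =i [seq [fset p.1; p.2] | p <- s].
  (* Induction along the enumeration of [M], ordering the two endpoints of each edge arbitrarily; by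
     [disjM] a new edge meets no earlier vertex. *)
  have : {subset enum_fset M <= M} by [].
  have := fset_uniq M; elim: (enum_fset M) => [|e r IHr] /=; first by exists [::].
  move=> /andP[er ur] erM; have [|s us rs] := IHr ur.
    by move=> f fr; apply: erM; rewrite inE fr orbT.
  have eM : e \in M by apply: erM; rewrite inE eqxx.
  have [p pp ep] := cardfs2_edge (graphM _ eM).2.
  exists (p :: s) => [|f]; last by rewrite /= !inE rs ep.
  have pNs x : x \in e -> x \notin vertices s.
    move=> xe; apply/negP => /flatten_mapP[q qs xq].
    have qr : [fset q.1; q.2] \in r by rewrite rs; apply/mapP; exists q.
    have qM : [fset q.1; q.2] \in M by apply: erM; rewrite inE qr orbT.
    have eq : e = [fset q.1; q.2] by apply: disjM xe _ => //; rewrite mem_edge.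
    by rewrite eq qr in er.
  by rewrite /= inE negb_or pp us !pNs// ep !inE eqxx ?orbT.
exists s => //; apply/fsetP => e; rewrite -[LHS]/(e \in enum_fset M) Ms.
apply/mapP/pairing_edgesP => -[p ps ->]; by exists p.
Qed.

Lemma max_sum_matching_pairing S M : max_sum_matching S M ->
  exists s, [/\ uniq (vertices s), max_pairing s & M = pairing_edges s].
Proof.
move=> [matchM maxM]; have [s [us Ss Ms]] := perfect_matching_exists_pairing matchM.
exists s; split => // s' s's; have us' : uniq (vertices s').
  by rewrite (perm_uniq s's).
rewrite -!cost_pairing// -Ms; apply: maxM; apply: perfect_matching_pairing => //.
by move=> v; rewrite Ss (perm_mem s's).
Qed.

End Pairings.

(** * Polar coordinates and endpoints of diameters *)

Section EuclideanPlane.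
Variable R : realType.
Local Notation point := 'rV[R]_2.
Implicit Types (u v w x y : point) (a b r : R).

Lemma enormE x : enorm x = Num.sqrt (x 0 0 ^+ 2 + x 0 1 ^+ 2).
Proof.
rewrite /enorm !big_ord_recl big_ord0 addr0; congr (Num.sqrt (_ + x 0 _ ^+ 2)).
exact: val_inj.
Qed.

Lemma enorm_ge0 x : 0 <= enorm x.
Proof. exact: sqrtr_ge0. Qed.

Lemma sqr_enorm x : enorm x ^+ 2 = x 0 0 ^+ 2 + x 0 1 ^+ 2.
Proof. by rewrite enormE sqr_sqrtr// addr_ge0 ?sqr_ge0. Qed.

Lemma ord2P (i : 'I_2) : i = 0 \/ i = 1.
Proof. by case: i => -[|[|//]] i2; [left|right]; exact: val_inj. Qed.

Lemma rV2P x y : x 0 0 = y 0 0 -> x 0 1 = y 0 1 -> x = y.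
Proof.
by move=> xy0 xy1; apply/rowP => i; case: (ord2P i) => ->.
Qed.

Lemma enorm_eq0 x : enorm x = 0 -> x = 0.
Proof.
move=> x0; have := sqr_enorm x; rewrite x0 => xE.
by apply: rV2P; rewrite mxE; nra.
Qed.

Lemma enorm_gt0 x : x != 0 -> 0 < enorm x.
Proof.
move=> x0; rewrite lt_def enorm_ge0 andbT.
by apply: contraNneq x0 => /enorm_eq0 ->.
Qed.

Definition dot u v : R := u 0 0 * v 0 0 + u 0 1 * v 0 1.
Definition cross u v : R := u 0 0 * v 0 1 - u 0 1 * v 0 0.

Lemma sqr_dot_cross u v :
  (enorm u * enorm v) ^+ 2 = dot u v ^+ 2 + cross u v ^+ 2.
Proof. by rewrite exprMn !sqr_enorm /dot /cross; ring. Qed.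

Lemma dot_le_enorm u v : dot u v <= enorm u * enorm v.
Proof.
have [duv|duv] := leP (dot u v) 0.
  by rewrite (le_trans duv)// mulr_ge0 ?enorm_ge0.
rewrite -[leLHS]ger0_norm ?(ltW duv)// -sqrtr_sqr.
rewrite -[leRHS]ger0_norm ?mulr_ge0 ?enorm_ge0// -sqrtr_sqr ler_wsqrtr//.
by rewrite sqr_dot_cross lerDl sqr_ge0.
Qed.

Lemma enormD u v : enorm (u + v) <= enorm u + enorm v.
Proof.
have := dot_le_enorm u v; have := enorm_ge0 u; have := enorm_ge0 v.
have := enorm_ge0 (u + v).
have := sqr_enorm (u + v); have := sqr_enorm u; have := sqr_enorm v.
rewrite !mxE /dot; nra.
Qed.

Lemma enormZ a u : enorm (a *: u) = `|a| * enorm u.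
Proof. by rewrite !enormE !mxE !exprMn -mulrDr sqrtrM ?sqr_ge0// sqrtr_sqr. Qed.

Lemma enormN u : enorm (- u) = enorm u.
Proof. by rewrite -scaleN1r enormZ normrN1 mul1r. Qed.

Definition polar r (theta : R) : point :=
  \row_(i < 2) (if i == 0 then r * cos theta else r * sin theta).

Lemma polar0 r theta : polar r theta 0 0 = r * cos theta.
Proof. by rewrite mxE. Qed.

Lemma polar1 r theta : polar r theta 0 1 = r * sin theta.
Proof. by rewrite mxE. Qed.

Lemma enorm_polar r theta : 0 <= r -> enorm (polar r theta) = r.
Proof.
move=> r0; rewrite enormE polar0 polar1 !exprMn -mulrDr cos2Dsin2 mulr1.
by rewrite sqrtr_sqr ger0_norm.
Qed.

Lemma polarD2pi r theta : polar r (theta + pi *+ 2) = polar r theta.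
Proof. by apply: rV2P; rewrite ?polar0 ?polar1 ?cosD2pi ?sinD2pi. Qed.

Lemma polarDpi r theta : polar r (theta + pi) = - polar r theta.
Proof. by apply: rV2P; rewrite ?mxE ?cosDpi ?sinDpi /= mulrN. Qed.

Lemma polarZ a r theta : polar (a * r) theta = a *: polar r theta.
Proof. by apply: rV2P; rewrite !mxE /= mulrA. Qed.

(** The arccosine of the normalized dot product gives the unsigned angle [kappa] to the direction
    [psi]; the sign of the cross product tells the side. *)
Lemma polarP (psi : R) v : exists2 kappa, 0 <= kappa <= pi &
  v = polar (enorm v) (psi + if 0 <= cross (polar 1 psi) v then kappa else - kappa).
Proof.
have [->|v0] := eqVneq v 0.
  exists 0; first by rewrite lexx pi_ge0.
  have -> : enorm (0 : point) = 0 by rewrite enormE !mxE expr0n addr0 sqrtr0.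
  by apply: rV2P; rewrite ?polar0 ?polar1 mul0r mxE.
have n0 := enorm_gt0 v0.
pose X := dot (polar 1 psi) v / enorm v.
have X2 : (cross (polar 1 psi) v / enorm v) ^+ 2 = 1 - X ^+ 2.
  rewrite /X !expr_div_n; apply: (mulIf (expf_neq0 2 (lt0r_neq0 n0))).
  rewrite mulrBl !divfK ?expf_neq0 ?lt0r_neq0//.
  apply/eqP; rewrite eq_sym subr_eq mul1r sqr_enorm /cross /dot !polar0 !polar1.
  apply/eqP; transitivity
    ((cos psi ^+ 2 + sin psi ^+ 2) * (v 0 0 ^+ 2 + v 0 1 ^+ 2)); last by ring.
  by rewrite cos2Dsin2 mul1r.
have X1 : -1 <= X <= 1.
  by have := sqr_ge0 (cross (polar 1 psi) v / enorm v); rewrite X2; nra.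
exists (acos X); first by rewrite acos_ge0// acos_lepi.
have cosX : cos (acos X) = X by rewrite acosK.
have sinX : sin (acos X) = `|cross (polar 1 psi) v| / enorm v.
  by rewrite sin_acos// -X2 sqrtr_sqr normrM (gtr0_norm (x := _^-1)) ?invr_gt0.
(* Coordinates of [v] in the orthonormal frame with directions [psi] and [psi + pi / 2]. *)
have vE : v = polar (dot (polar 1 psi) v) psi
            + polar (cross (polar 1 psi) v) (psi + pi / 2).
  have := cos2Dsin2 psi.
  move=> cs; apply: rV2P; rewrite !mxE /= ?cosDpihalf ?sinDpihalf /dot /cross ?polar0 ?polar1.
    by rewrite -[LHS]mul1r -{1}cs; ring.
  by rewrite -[LHS]mul1r -{1}cs; ring.
rewrite {1}vE; case: ifPn => [c0|]; last rewrite -ltNge => c0.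
- apply: rV2P; rewrite !mxE /= !(cosD psi, sinD psi) cosX sinX.
    by rewrite cos_pihalf sin_pihalf ger0_norm// /X; field; exact: lt0r_neq0.
  by rewrite cos_pihalf sin_pihalf ger0_norm// /X; field; exact: lt0r_neq0.
- apply: rV2P; rewrite !mxE /= !(cosD psi, sinD psi) cosN sinN cosX sinX.
    by rewrite cos_pihalf sin_pihalf ltr0_norm// /X; field; exact: lt0r_neq0.
  by rewrite cos_pihalf sin_pihalf ltr0_norm// /X; field; exact: lt0r_neq0.
Qed.

(* [endpoint 1 rho psi phi] lies on the circle through the origin with center
   [polar rho psi], at angle [- phi] from that center as seen from the origin;
   smaller [k] move it towards the center. The opposite endpoint of the
   diameter is obtained by replacing [phi] with [phi - pi / 2]. *)
Definition endpoint (k rho psi phi : R) : point :=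
  polar rho psi + polar (k * rho) (psi - phi *+ 2).

Lemma endpointD2pi k rho psi phi :
  endpoint k rho (psi + pi *+ 2) phi = endpoint k rho psi phi.
Proof. by rewrite /endpoint -addrAC !polarD2pi. Qed.

Lemma endpointN k rho psi phi :
  endpoint k rho psi (phi - pi / 2) = polar rho psi - polar (k * rho) (psi - phi *+ 2).
Proof.
rewrite /endpoint -polarDpi; congr (_ + polar _ _).
by field.
Qed.

(** Inscribed angle: the chord from the origin at angle [phi] to the radius has length
    [2 * rho * cos phi], while its far end turns by [2 phi] about the center. *)
Lemma endpoint1 rho psi phi :
  endpoint 1 rho psi phi = polar (2 * rho * cos phi) (psi - phi).
Proof.
rewrite /endpoint mul1r.
have [-> ->] : psi = psi - phi + phi /\ psi - phi *+ 2 = psi - phi - phi.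
  by split; ring.
move: (psi - phi) => theta; rewrite addrK.
by apply: rV2P; rewrite !mxE /= ?(cosD theta phi) ?(sinD theta phi)
  ?(cosB theta phi) ?(sinB theta phi); ring.
Qed.

Lemma sqr_edist_polar r1 r2 t1 t2 :
  enorm (polar r1 t1 - polar r2 t2) ^+ 2
    = r1 ^+ 2 + r2 ^+ 2 - 2 * r1 * r2 * cos (t2 - t1).
Proof.
rewrite sqr_enorm !mxE /= cosB.
rewrite -[X in _ = X + _ - _]mulr1 -{1}(cos2Dsin2 t1).
rewrite -[X in _ = _ + X - _]mulr1 -{1}(cos2Dsin2 t2).
ring.
Qed.

(* Both products are half of a sum [cos (t2 - t1) + cos (phi1 +- phi2)], where
   [t1] and [t2] are the directions of the two endpoints. *)
Definition facing (delta phi1 phi2 : R) : bool :=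
  (cos (delta / 2 + phi1) * cos (delta / 2 - phi2) <= 0) ||
  (cos (delta / 2 + phi1 - phi2) * cos (delta / 2) <= 0).

Definition strictly_facing (delta phi1 phi2 : R) : bool :=
  (cos (delta / 2 + phi1) * cos (delta / 2 - phi2) < 0) ||
  (cos (delta / 2 + phi1 - phi2) * cos (delta / 2) < 0).

Lemma cos_prod_sum (x y : R) : 2 * (cos x * cos y) = cos (x + y) + cos (x - y).
Proof. by rewrite cosD cosB; ring. Qed.

Lemma facing_prod (delta phi1 phi2 : R) :
  2 * (cos (delta / 2 + phi1) * cos (delta / 2 - phi2)) =
  cos (delta + phi1 - phi2) + cos (phi1 + phi2).
Proof. by rewrite cos_prod_sum; congr (cos _ + cos _); field. Qed.

Lemma facing_prod' (delta phi1 phi2 : R) :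
  2 * (cos (delta / 2 + phi1 - phi2) * cos (delta / 2)) =
  cos (delta + phi1 - phi2) + cos (phi1 - phi2).
Proof. by rewrite cos_prod_sum; congr (cos _ + cos _); field. Qed.

(** This is [|p - o|^2 / h] with [h = 2 * rho] and [|p - o| = 2 * rho * |cos phi|]. *)
Definition weight (rho phi : R) : R := 2 * rho * cos phi ^+ 2.

Lemma weightN rho phi : weight rho phi + weight rho (phi - pi / 2) = 2 * rho.
Proof. by rewrite /weight cosBpihalf -mulrDr cos2Dsin2 mulr1. Qed.

(** The origin and a diameter form a right triangle in which the weight is the projection of a leg
    to the hypotenuse and [2 * rho * cos phi * sin phi] the signed altitude, so a squared leg is the
    sum of their squares. The law of cosines supplies the mixed term. *)
Lemma sqr_edist_endpoint (rho1 rho2 psi delta phi1 phi2 : R) :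
  enorm (endpoint 1 rho1 psi phi1 - endpoint 1 rho2 (psi + delta) phi2) ^+ 2 =
  (weight rho1 phi1 + weight rho2 phi2) ^+ 2
  + (2 * rho1 * cos phi1 * sin phi1 - 2 * rho2 * cos phi2 * sin phi2) ^+ 2
  - 16 * (rho1 * cos phi1 * (rho2 * cos phi2)) *
    (cos (delta / 2 + phi1) * cos (delta / 2 - phi2)).
Proof.
rewrite !endpoint1 sqr_edist_polar.
have -> : psi + delta - phi2 - (psi - phi1) = delta + phi1 - phi2 by ring.
have := facing_prod delta phi1 phi2; rewrite (cosD phi1) => /(canRL (mulKf (lt0r_neq0 (ltr0Sn R 1)))) ->.
rewrite /weight; have := cos2Dsin2 phi1; have := cos2Dsin2 phi2.
move: (cos phi1) (cos phi2) (sin phi1) (sin phi2) => c1 c2 s1 s2.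
move=> /(canRL (addKr _)) e2 /(canRL (addKr _)) e1.
have -> : (2 * rho1 * c1 * s1 - 2 * rho2 * c2 * s2) ^+ 2 =
  4 * rho1 ^+ 2 * c1 ^+ 2 * s1 ^+ 2 + 4 * rho2 ^+ 2 * c2 ^+ 2 * s2 ^+ 2 -
  8 * rho1 * rho2 * c1 * c2 * s1 * s2 by ring.
by rewrite e1 e2; field.
Qed.

(** Reversing one altitude trades [cos (phi1 + phi2)] for [cos (phi1 - phi2)], which makes the
    second alternative of [facing] equally good. *)
Lemma sqr_edist_endpoint' (rho1 rho2 psi delta phi1 phi2 : R) :
  enorm (endpoint 1 rho1 psi phi1 - endpoint 1 rho2 (psi + delta) phi2) ^+ 2 =
  (weight rho1 phi1 + weight rho2 phi2) ^+ 2
  + (2 * rho1 * cos phi1 * sin phi1 + 2 * rho2 * cos phi2 * sin phi2) ^+ 2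
  - 16 * (rho1 * cos phi1 * (rho2 * cos phi2)) *
    (cos (delta / 2 + phi1 - phi2) * cos (delta / 2)).
Proof.
rewrite sqr_edist_endpoint.
have := facing_prod delta phi1 phi2; rewrite (cosD phi1) => /(canRL (mulKf (lt0r_neq0 (ltr0Sn R 1)))) ->.
have := facing_prod' delta phi1 phi2; rewrite (cosB phi1) => /(canRL (mulKf (lt0r_neq0 (ltr0Sn R 1)))) ->.
by field.
Qed.

Lemma weight_ge0 rho phi : 0 <= rho -> 0 <= weight rho phi.
Proof. by move=> r0; rewrite /weight mulr_ge0 ?sqr_ge0 ?mulr_ge0. Qed.

Lemma edist_facing (rho1 rho2 psi delta phi1 phi2 : R) :
  0 <= rho1 -> 0 <= rho2 -> 0 <= cos phi1 -> 0 <= cos phi2 ->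
  facing delta phi1 phi2 ->
  weight rho1 phi1 + weight rho2 phi2 <=
  enorm (endpoint 1 rho1 psi phi1 - endpoint 1 rho2 (psi + delta) phi2).
Proof.
move=> r1 r2 c1 c2 fac.
have PQ := mulr_ge0 (mulr_ge0 r1 c1) (mulr_ge0 r2 c2).
rewrite -(ler_pXn2r (n := 2)) ?nnegrE ?enorm_ge0 ?addr_ge0 ?weight_ge0//.
case/orP: fac => /(mulr_ge0_le0 PQ) fac.
  by rewrite sqr_edist_endpoint -addrA lerDl addr_ge0 ?sqr_ge0// oppr_ge0; lra.
by rewrite sqr_edist_endpoint' -addrA lerDl addr_ge0 ?sqr_ge0// oppr_ge0; lra.
Qed.

Lemma edist_strictly_facing (rho1 rho2 psi delta phi1 phi2 : R) :
  0 < rho1 -> 0 < rho2 -> 0 <= cos phi1 -> 0 <= cos phi2 ->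
  strictly_facing delta phi1 phi2 ->
  sin phi1 * cos phi1 != 0 \/ sin phi2 * cos phi2 != 0 ->
  weight rho1 phi1 + weight rho2 phi2 <
  enorm (endpoint 1 rho1 psi phi1 - endpoint 1 rho2 (psi + delta) phi2).
Proof.
move=> r1 r2 c1 c2 fac nondeg.
rewrite -(ltr_pXn2r (n := 2)) ?nnegrE ?enorm_ge0 ?addr_ge0 ?weight_ge0 ?ltW//.
(* If one endpoint is the origin, the product term vanishes and strictness comes from the nonzero
   altitude of the other diameter. *)
have [/eqP PQ0|PQ0] := boolP (rho1 * cos phi1 * (rho2 * cos phi2) == 0).
  rewrite sqr_edist_endpoint PQ0 mulr0 mul0r subr0 ltrDl lt_def sqr_ge0 andbT.
  rewrite sqrf_eq0.
  have r10 := lt0r_neq0 r1; have r20 := lt0r_neq0 r2.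
  move/eqP: PQ0; rewrite !mulf_eq0 (negPf r10) (negPf r20) /= => /orP[] /eqP c0.
    rewrite c0 mulr0 mul0r sub0r oppr_eq0 !mulf_eq0 (negPf r20) pnatr_eq0 /=.
    by case: nondeg; rewrite ?c0 ?mulr0 ?eqxx// mulf_eq0 orbC.
  rewrite c0 mulr0 mul0r subr0 !mulf_eq0 (negPf r10) pnatr_eq0 /=.
  by case: nondeg; rewrite ?c0 ?mulr0 ?eqxx// mulf_eq0 orbC.
have PQ : 0 < rho1 * cos phi1 * (rho2 * cos phi2).
  by rewrite lt_def PQ0 !mulr_ge0// ltW.
case/orP: fac; rewrite -(pmulr_rlt0 _ PQ) => fac.
  rewrite sqr_edist_endpoint -addrA ltrDl ltr_wpDl ?sqr_ge0// oppr_gt0; lra.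
rewrite sqr_edist_endpoint' -addrA ltrDl ltr_wpDl ?sqr_ge0// oppr_gt0; lra.
Qed.

(** * Shrinking the diameters about their centers *)

Lemma endpoint_shrink (k rho psi phi : R) : 0 <= rho -> k <= 1 ->
  enorm (endpoint 1 rho psi phi - endpoint k rho psi phi) = (1 - k) * rho.
Proof.
move=> r0 k1; rewrite /endpoint.
set c := polar rho psi; rewrite (opprD c) addrACA subrr add0r.
rewrite (polarZ 1) (polarZ k) -scalerBl enormZ enorm_polar//.
by rewrite ger0_norm// subr_ge0.
Qed.

Lemma edist_shrink (k rho1 rho2 psi1 psi2 phi1 phi2 : R) :
  0 <= rho1 -> 0 <= rho2 -> k <= 1 ->
  enorm (endpoint 1 rho1 psi1 phi1 - endpoint 1 rho2 psi2 phi2) <=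
  enorm (endpoint k rho1 psi1 phi1 - endpoint k rho2 psi2 phi2)
  + (1 - k) * (rho1 + rho2).
Proof.
move=> r1 r2 k1; rewrite mulrDr.
rewrite -(endpoint_shrink psi1 phi1 r1 k1) -(endpoint_shrink psi2 phi2 r2 k1).
set p := endpoint 1 _ _ _; set q := endpoint 1 _ _ _.
set p' := endpoint k _ _ _; set q' := endpoint k _ _ _.
rewrite -(enormN (q - q')) opprB.
have -> : p - q = (p' - q') + ((p - p') + (q' - q)).
  by clearbody p q p' q'; apply: rV2P; rewrite !mxE; ring.
by apply: (le_trans (enormD _ _)); rewrite lerD2l enormD.
Qed.

Lemma edist_facing_shrink (k rho1 rho2 psi delta phi1 phi2 : R) :
  0 <= rho1 -> 0 <= rho2 -> k <= 1 -> 0 <= cos phi1 -> 0 <= cos phi2 ->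
  facing delta phi1 phi2 ->
  weight rho1 phi1 + weight rho2 phi2 - (1 - k) * (rho1 + rho2) <=
  enorm (endpoint k rho1 psi phi1 - endpoint k rho2 (psi + delta) phi2).
Proof.
move=> r1 r2 k1 c1 c2 fac; rewrite lerBlDr.
by apply: le_trans (edist_facing psi r1 r2 c1 c2 fac) _; exact: edist_shrink.
Qed.

(* When both stretched diameters have an endpoint at the origin, the bound may
   be attained before shrinking; strictness then comes from [k < 1]. *)
Lemma edist_strictly_facing_shrink (k rho1 rho2 psi delta phi1 phi2 : R) :
  0 < rho1 -> 0 < rho2 -> 0 < k <= 1 -> 0 <= cos phi1 -> 0 <= cos phi2 ->
  0 < delta < pi -> strictly_facing delta phi1 phi2 ->
  (k = 1 -> sin phi1 * cos phi1 != 0 \/ sin phi2 * cos phi2 != 0) ->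
  weight rho1 phi1 + weight rho2 phi2 - (1 - k) * (rho1 + rho2) <
  enorm (endpoint k rho1 psi phi1 - endpoint k rho2 (psi + delta) phi2).
Proof.
move=> r1 r2 /andP[k0 k1] c1 c2 /andP[d0 dpi] fac nondeg.
have [deg|nd] := boolP ((sin phi1 * cos phi1 == 0) && (sin phi2 * cos phi2 == 0)); last first.
  rewrite ltrBlDr; apply: lt_le_trans (edist_shrink _ _ _ _ (ltW r1) (ltW r2) k1).
  apply: edist_strictly_facing => //.
  by move: nd; rewrite negb_and => /orP.
move/andP: deg => [/eqP deg1 /eqP deg2].
have {nondeg k1} k1 : k < 1.
  rewrite lt_def k1 andbT eq_sym; apply/eqP => kE.
  by case: (nondeg kE); rewrite ?deg1 ?deg2 eqxx.
(* A degenerate endpoint is the origin or its antipode on the circle; the shrunk one lies on the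
   line to the center, at [rho * (1 - k)] or [rho * (1 + k)]. *)
have endpt rho psi' phi : sin phi * cos phi = 0 ->
    endpoint k rho psi' phi = polar (rho * (1 + k * (2 * cos phi ^+ 2 - 1))) psi'.
  move=> deg; have cs := cos2Dsin2 phi.
  have [c s] : cos (phi *+ 2) = 2 * cos phi ^+ 2 - 1 /\ sin (phi *+ 2) = 0.
    rewrite mulr2n cosD sinD -!expr2; split; last by rewrite [cos phi * _]mulrC deg addr0.
    by lra.
  by apply: rV2P; rewrite !mxE /= ?(cosB psi') ?(sinB psi') c s; ring.
rewrite !endpt//.
have cos2 (phi : R) : 0 <= cos phi -> sin phi * cos phi = 0 ->
    cos phi = 0 \/ cos phi = 1 /\ sin phi = 0.
  move=> c0 /eqP; rewrite mulf_eq0 => /orP[] /eqP z; [right|by left].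
  by split => //; have := cos2Dsin2 phi; rewrite z; nra.
have sd := sin_gt0_pi (introT andP (conj d0 dpi)).
have csd := cos2Dsin2 delta.
have c2d : 0 < cos (delta / 2) by apply: cos_gt0_pihalf; apply/andP; split; lra.
have D2 A B : enorm (polar A psi - polar B (psi + delta)) ^+ 2 =
    A ^+ 2 + B ^+ 2 - 2 * A * B * cos delta.
  by rewrite sqr_edist_polar [psi + _]addrC addrK.
have D0 A B := enorm_ge0 (polar A psi - polar B (psi + delta)).
(* The reverse triangle inequality is strict for points on two rays of different directions. *)
have rev (A B : R) : 0 < A -> 0 < B ->
    A - B < enorm (polar A psi - polar B (psi + delta)) /\
    B - A < enorm (polar A psi - polar B (psi + delta)).
  move=> A0 B0; have := D2 A B; have := D0 A B; have AB := mulr_gt0 A0 B0.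
  have : 0 < A * B * (1 - cos delta) by apply: mulr_gt0 => //; nra.
  by move: (enorm _) => D ? ? ?; split; nra.
(* With both endpoints at the origin the left side is negative; with one there, it is the difference
   bounded by [rev]; with none, both products equal [cos (delta / 2) ^+ 2], against strict
   facing. *)
have [c1E|[c1E s1E]] := cos2 _ c1 deg1; have [c2E|[c2E s2E]] := cos2 _ c2 deg2;
  rewrite /weight c1E c2E.
- apply: lt_le_trans (D0 _ _).
  have k1' : 0 < 1 - k by lra.
  by have := mulr_gt0 k1' r1; have := mulr_gt0 k1' r2; nra.
- have [||_] := rev (rho1 * (1 - k)) (rho2 * (1 + k)); rewrite ?mulr_gt0//; try lra.
  rewrite (_ : 1 + k * (2 * 0 ^+ 2 - 1) = 1 - k); last by ring.
  rewrite (_ : 1 + k * (2 * 1 ^+ 2 - 1) = 1 + k); last by ring.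
  by apply: le_lt_trans; nra.
- have [||+ _] := rev (rho1 * (1 + k)) (rho2 * (1 - k)); rewrite ?mulr_gt0//; try lra.
  rewrite (_ : 1 + k * (2 * 0 ^+ 2 - 1) = 1 - k); last by ring.
  rewrite (_ : 1 + k * (2 * 1 ^+ 2 - 1) = 1 + k); last by ring.
  by apply: le_lt_trans; nra.
- exfalso; move: fac; rewrite /strictly_facing.
  have -> : cos (delta / 2 + phi1 - phi2) = cos (delta / 2).
    by rewrite -addrA cosD cosB sinB c1E c2E s1E s2E; ring.
  rewrite (cosD _ phi1) (cosB _ phi2) c1E c2E s1E s2E => /orP[]; nra.
Qed.

End EuclideanPlane.

(** * Three diameters around a point *)

Section Facing.
Variable R : realType.
Variables (delta phi1 phi2 : R).
Hypotheses (delta_pi : 0 < delta < pi) (phi1_pi : 0 <= phi1 <= pi / 2)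
  (phi2_pi : 0 <= phi2 <= pi / 2).

Let cos_half : 0 < cos (delta / 2).
Proof. by apply: cos_gt0_pihalf; move: delta_pi; lra. Qed.

Let cos_half_sub : 0 < cos (delta / 2 - phi2).
Proof. by apply: cos_gt0_pihalf; move: delta_pi phi2_pi; lra. Qed.

Let sin_half_add : 0 < sin (delta / 2 + phi1).
Proof. by apply: sin_gt0_pi; move: delta_pi phi1_pi; lra. Qed.

(** One cosine is positive, and the bound on the tilts makes the other the negative of a sine of an
    angle in [[0, pi]]. The other combinations of the ends A (parameter [phi]) and B (parameter
    [phi - pi / 2]) work alike. *)
Lemma facing_AB : phi2 - phi1 <= delta / 2 -> facing delta phi1 (phi2 - pi / 2).
Proof.
move=> h; apply/orP; right.
rewrite (_ : _ - _ = delta / 2 + phi1 - phi2 + pi / 2); last by ring.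
rewrite cosDpihalf pmulr_lle0// oppr_le0 sin_ge0_pi//.
by move: delta_pi phi1_pi phi2_pi; lra.
Qed.

Lemma strictly_facing_AB :
  phi2 - phi1 < delta / 2 -> strictly_facing delta phi1 (phi2 - pi / 2).
Proof.
move=> h; apply/orP; right.
rewrite (_ : _ - _ = delta / 2 + phi1 - phi2 + pi / 2); last by ring.
rewrite cosDpihalf pmulr_llt0// oppr_lt0 sin_gt0_pi//.
by move: delta_pi phi1_pi phi2_pi; lra.
Qed.

Lemma strictly_facing_BA :
  delta / 2 < phi2 - phi1 -> strictly_facing delta (phi1 - pi / 2) phi2.
Proof.
move=> h; apply/orP; right.
rewrite (_ : _ - _ = - (phi2 - phi1 - delta / 2) - pi / 2); last by ring.
rewrite cosBpihalf sinN pmulr_llt0// oppr_lt0 sin_gt0_pi//.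
by move: delta_pi phi1_pi phi2_pi; lra.
Qed.

Lemma facing_BB :
  phi2 <= delta / 2 -> facing delta (phi1 - pi / 2) (phi2 - pi / 2).
Proof.
move=> h; apply/orP; left.
rewrite addrA cosBpihalf pmulr_rle0//.
rewrite (_ : _ - _ = delta / 2 - phi2 + pi / 2); last by ring.
rewrite cosDpihalf oppr_le0 sin_ge0_pi//.
by move: delta_pi phi2_pi; lra.
Qed.

Lemma strictly_facing_BB :
  phi2 < delta / 2 -> strictly_facing delta (phi1 - pi / 2) (phi2 - pi / 2).
Proof.
move=> h; apply/orP; left.
rewrite addrA cosBpihalf pmulr_rlt0//.
rewrite (_ : _ - _ = delta / 2 - phi2 + pi / 2); last by ring.
rewrite cosDpihalf oppr_lt0 sin_gt0_pi//.
by move: delta_pi phi2_pi; lra.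
Qed.

Lemma facing_AA : pi / 2 - phi1 <= delta / 2 -> facing delta phi1 phi2.
Proof.
move=> h; apply/orP; left; rewrite pmulr_lle0//.
rewrite (_ : _ + _ = delta / 2 + phi1 - pi / 2 + pi / 2); last by ring.
rewrite cosDpihalf oppr_le0 sin_ge0_pi//.
by move: delta_pi phi1_pi; lra.
Qed.

Lemma strictly_facing_AA :
  pi / 2 - phi1 < delta / 2 -> strictly_facing delta phi1 phi2.
Proof.
move=> h; apply/orP; left; rewrite pmulr_llt0//.
rewrite (_ : _ + _ = delta / 2 + phi1 - pi / 2 + pi / 2); last by ring.
rewrite cosDpihalf oppr_lt0 sin_gt0_pi//.
by move: delta_pi phi1_pi; lra.
Qed.

End Facing.

(** The data describe the stretched diameter, whose circle passes through [o]: the polar coordinates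
    of its center about [o], and the angle at [o] from the center clockwise to the end A. *)
Record diameter (R : realType) := Diameter { radius : R; dir : R; tilt : R }.

Section Triple.
Variables (R : realType) (o : 'rV[R]_2) (k : R).
Hypothesis k01 : 0 < k <= 1.
Implicit Types d : diameter R.

Definition endA d := o + endpoint k (radius d) (dir d) (tilt d).
Definition endB d := o + endpoint k (radius d) (dir d) (tilt d - pi / 2).
Definition wA d := weight (radius d) (tilt d).
Definition wB d := weight (radius d) (tilt d - pi / 2).
Definition valid d := 0 < radius d /\ 0 <= tilt d <= pi / 2.
(** For positive radius: neither end of the stretched diameter is [o]. *)
Definition oblique d := sin (tilt d) * cos (tilt d) != 0.
(** The same segment one full turn later, so that the angle from the last diameter around to the
    first is a difference of real numbers. *)
Definition turn d := Diameter (radius d) (dir d + pi *+ 2) (tilt d).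
Definition ccw d1 d2 := 0 < dir d2 - dir d1 < pi.
(** A bound for the distance lost between an endpoint of each. Over pairs that use every diameter
    twice, these bounds add up to the loss in the cost of the diameters themselves. *)
Definition shrinkage d1 d2 := (1 - k) * (radius d1 + radius d2).

Lemma endA_turn d : endA (turn d) = endA d.
Proof. by rewrite /endA endpointD2pi. Qed.

Lemma endB_turn d : endB (turn d) = endB d.
Proof. by rewrite /endB endpointD2pi. Qed.

Lemma wAB d : wA d + wB d = 2 * radius d.
Proof. exact: weightN. Qed.

Lemma edistDl (p q : 'rV[R]_2) : edist (o + p) (o + q) = enorm (p - q).
Proof. by rewrite /edist opprD addrACA subrr add0r. Qed.

Lemma edist_diameter d : valid d -> edist (endA d) (endB d) = 2 * (k * radius d).
Proof.
move=> [r0 _]; rewrite edistDl endpointN /endpoint opprB addrC addrA subrK.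
rewrite -mulr2n -scaler_nat enormZ enorm_polar ?ger0_norm//.
by rewrite mulr_ge0 ?ltW//; case/andP: k01.
Qed.

Lemma cos_tilt d : valid d -> 0 <= cos (tilt d).
Proof. by move=> [_ t]; apply: cos_ge0_pihalf; have := pi_gt0 R; lra. Qed.

Lemma cos_tiltB d : valid d -> 0 <= cos (tilt d - pi / 2).
Proof.
by move=> [_ t]; rewrite cosBpihalf sin_ge0_pi//; have := pi_gt0 R; lra.
Qed.

Lemma obliqueB d : oblique d -> sin (tilt d - pi / 2) * cos (tilt d - pi / 2) != 0.
Proof. by rewrite cosBpihalf sinBpihalf mulNr oppr_eq0 mulrC. Qed.

Let le_edist d1 d2 phi1 phi2 : valid d1 -> valid d2 -> 
  0 <= cos phi1 -> 0 <= cos phi2 ->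
  facing (dir d2 - dir d1) phi1 phi2 ->
  weight (radius d1) phi1 + weight (radius d2) phi2 - shrinkage d1 d2 <=
  edist (o + endpoint k (radius d1) (dir d1) phi1)
        (o + endpoint k (radius d2) (dir d2) phi2).
Proof.
move=> [r1 _] [r2 _] c1 c2 fac; rewrite edistDl.
have /andP[_ k1] := k01; have -> : dir d2 = dir d1 + (dir d2 - dir d1) by ring.
by apply: edist_facing_shrink => //; exact: ltW.
Qed.

Let lt_edist d1 d2 phi1 phi2 : valid d1 -> valid d2 -> 
  0 <= cos phi1 -> 0 <= cos phi2 -> ccw d1 d2 ->
  strictly_facing (dir d2 - dir d1) phi1 phi2 ->
  (k = 1 -> sin phi1 * cos phi1 != 0 \/ sin phi2 * cos phi2 != 0) ->
  weight (radius d1) phi1 + weight (radius d2) phi2 - shrinkage d1 d2 <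
  edist (o + endpoint k (radius d1) (dir d1) phi1)
        (o + endpoint k (radius d2) (dir d2) phi2).
Proof.
move=> [r1 _] [r2 _] c1 c2 d12 fac nd; rewrite edistDl.
have -> : dir d2 = dir d1 + (dir d2 - dir d1) by ring.
exact: edist_strictly_facing_shrink.
Qed.

Section Pair.
Variables d1 d2 : diameter R.
Hypotheses (v1 : valid d1) (v2 : valid d2) (d12 : ccw d1 d2).
Hypothesis ob : k = 1 -> oblique d1 \/ oblique d2.
Let H := (dir d2 - dir d1) / 2.

Lemma le_edist_AB : tilt d2 - tilt d1 <= H ->
  wA d1 + wB d2 - shrinkage d1 d2 <= edist (endA d1) (endB d2).
Proof.
move=> h; apply: le_edist (cos_tilt v1) (cos_tiltB v2) _ => //.
by case: v1 v2 => [_ t1] [_ t2]; exact: facing_AB.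
Qed.

Lemma lt_edist_AB : tilt d2 - tilt d1 < H ->
  wA d1 + wB d2 - shrinkage d1 d2 < edist (endA d1) (endB d2).
Proof.
move=> h; apply: lt_edist (cos_tilt v1) (cos_tiltB v2) _ _ _ => //.
  by case: v1 v2 => [_ t1] [_ t2]; exact: strictly_facing_AB.
by move=> /ob[?|/obliqueB ?]; [left|right].
Qed.

Lemma lt_edist_BA : H < tilt d2 - tilt d1 ->
  wB d1 + wA d2 - shrinkage d1 d2 < edist (endB d1) (endA d2).
Proof.
move=> h; apply: lt_edist (cos_tiltB v1) (cos_tilt v2) _ _ _ => //.
  by case: v1 v2 => [_ t1] [_ t2]; exact: strictly_facing_BA.
by move=> /ob[/obliqueB ?|?]; [left|right].
Qed.

Lemma le_edist_BB : tilt d2 <= H ->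
  wB d1 + wB d2 - shrinkage d1 d2 <= edist (endB d1) (endB d2).
Proof.
move=> h; apply: le_edist (cos_tiltB v1) (cos_tiltB v2) _ => //.
by case: v1 v2 => [_ t1] [_ t2]; exact: facing_BB.
Qed.

Lemma lt_edist_BB : tilt d2 < H ->
  wB d1 + wB d2 - shrinkage d1 d2 < edist (endB d1) (endB d2).
Proof.
move=> h; apply: lt_edist (cos_tiltB v1) (cos_tiltB v2) _ _ _ => //.
  by case: v1 v2 => [_ t1] [_ t2]; exact: strictly_facing_BB.
by move=> /ob[/obliqueB ?|/obliqueB ?]; [left|right].
Qed.

Lemma le_edist_AA : pi / 2 - tilt d1 <= H ->
  wA d1 + wA d2 - shrinkage d1 d2 <= edist (endA d1) (endA d2).
Proof.
move=> h; apply: le_edist (cos_tilt v1) (cos_tilt v2) _ => //.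
by case: v1 v2 => [_ t1] [_ t2]; exact: facing_AA.
Qed.

Lemma lt_edist_AA : pi / 2 - tilt d1 < H ->
  wA d1 + wA d2 - shrinkage d1 d2 < edist (endA d1) (endA d2).
Proof.
move=> h; apply: lt_edist (cos_tilt v1) (cos_tilt v2) _ _ _ => //.
by case: v1 v2 => [_ t1] [_ t2]; exact: strictly_facing_AA.
Qed.

End Pair.

Definition diameter_pair d := (endA d, endB d).

(** * Exchanges among three diameters *)

Section Improve.
Variables d1 d2 d3 : diameter R.
Hypotheses (v1 : valid d1) (v2 : valid d2) (v3 : valid d3).
Hypotheses (d12 : ccw d1 d2) (d23 : ccw d2 d3) (d31 : ccw d3 (turn d1)).
Hypotheses (ob12 : k = 1 -> oblique d1 \/ oblique d2)
  (ob23 : k = 1 -> oblique d2 \/ oblique d3)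
  (ob31 : k = 1 -> oblique d3 \/ oblique d1).
Hypothesis max123 : max_pairing [seq diameter_pair d | d <- [:: d1; d2; d3]].

Let v1' : valid (turn d1) := v1.
Let ob31' : k = 1 -> oblique d3 \/ oblique (turn d1) := ob31.

Let le_cost s : perm_eq (vertices s)
    [:: endA d1; endB d1; endA d2; endB d2; endA d3; endB d3] ->
  pairing_cost s <= 2 * (k * radius d1) + 2 * (k * radius d2) + 2 * (k * radius d3).
Proof.
move=> /max123; rewrite /pairing_cost !big_cons big_nil /= !edist_diameter//.
by rewrite addr0 addrA.
Qed.

Let wAB123 : [/\ wA d1 + wB d1 = 2 * radius d1, wA d2 + wB d2 = 2 * radius d2 &
  wA d3 + wB d3 = 2 * radius d3].
Proof. by rewrite !wAB. Qed.

(** The exchange joins each A to the next B. The halved turning angles add up to [pi] and the tilt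
    differences to 0, so one of the three inequalities is strict. *)
Lemma not_max_triple_cyclic :
  tilt d2 - tilt d1 <= (dir d2 - dir d1) / 2 ->
  tilt d3 - tilt d2 <= (dir d3 - dir d2) / 2 ->
  tilt d1 - tilt d3 <= (dir (turn d1) - dir d3) / 2 -> False.
Proof.
move=> h12 h23 h31; have [w1 w2 w3] := wAB123.
have /le_cost : perm_eq
    (vertices [:: (endA d1, endB d2); (endA d2, endB d3); (endA d3, endB d1)])
    [:: endA d1; endB d1; endA d2; endB d2; endA d3; endB d3].
  (* Lists are permutations of each other when every predicate has equal counts on them, here an
     identity between sums. *)
  by apply/permP => P /=; ring.
rewrite /pairing_cost !big_cons big_nil /= addr0.
have := le_edist_AB v1 v2 d12 h12; have := le_edist_AB v2 v3 d23 h23.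
have := le_edist_AB v3 v1' d31 h31; rewrite endB_turn.
rewrite -[wB (turn d1)]/(wB d1) /shrinkage /=.
have [h12'|h12'] := ltP (tilt d2 - tilt d1) ((dir d2 - dir d1) / 2).
  by have := lt_edist_AB v1 v2 d12 ob12 h12'; rewrite /shrinkage; lra.
have [h23'|h23'] := ltP (tilt d3 - tilt d2) ((dir d3 - dir d2) / 2).
  by have := lt_edist_AB v2 v3 d23 ob23 h23'; rewrite /shrinkage; lra.
have h31' : tilt (turn d1) - tilt d3 < (dir (turn d1) - dir d3) / 2.
  by have := pi_gt0 R; rewrite /=; lra.
have := lt_edist_AB v3 v1' d31 ob31' h31'; rewrite endB_turn.
by rewrite -[wB (turn d1)]/(wB d1) /shrinkage /=; lra.
Qed.

(** The pair [endB d1], [endA d2] is now strictly facing. Either it extends to an exchange of all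
    three diameters, or the position of [tilt d3] gives an exchange of two. *)
Lemma not_max_triple_reversed :
  (dir d2 - dir d1) / 2 < tilt d2 - tilt d1 -> False.
Proof.
move=> h12; have [w1 w2 w3] := wAB123.
have d12E := d12; have d23E := d23; have d31E := d31.
rewrite /ccw /= in d12E d23E d31E.
have [_ t1] := v1; have [_ t2] := v2; have [_ t3] := v3.
(* A large [tilt d3] allows joining A to A and B to B between [d3] and [d1], keeping [d2]. *)
have [h23|h23] := leP (tilt d3) ((dir d3 - dir d2) / 2); last first.
  have /le_cost : perm_eq
      (vertices [:: (endA d3, endA d1); (endB d3, endB d1); (endA d2, endB d2)])
      [:: endA d1; endB d1; endA d2; endB d2; endA d3; endB d3].
    by apply/permP => P /=; ring.
  rewrite /pairing_cost !big_cons big_nil /= addr0 edist_diameter//.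
  have /(lt_edist_AA v3 v1' d31 ob31') :
      pi / 2 - tilt d3 < (dir (turn d1) - dir d3) / 2 by rewrite /=; lra.
  have /(le_edist_BB v3 v1' d31) :
      tilt (turn d1) <= (dir (turn d1) - dir d3) / 2 by rewrite /=; lra.
  rewrite endA_turn endB_turn -[wB (turn d1)]/(wB d1) -[wA (turn d1)]/(wA d1).
  by rewrite /shrinkage /=; lra.
(* A small [tilt d3] allows the same between [d2] and [d3], keeping [d1]. *)
have [h31|h31] := leP (pi / 2 - tilt d3) ((dir (turn d1) - dir d3) / 2); last first.
  rewrite /= in h31.
  have /le_cost : perm_eq
      (vertices [:: (endA d2, endA d3); (endB d2, endB d3); (endA d1, endB d1)])
      [:: endA d1; endB d1; endA d2; endB d2; endA d3; endB d3].
    by apply/permP => P /=; ring.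
  rewrite /pairing_cost !big_cons big_nil /= addr0 edist_diameter//.
  have /(le_edist_AA v2 v3 d23) : pi / 2 - tilt d2 <= (dir d3 - dir d2) / 2.
    by lra.
  have /(lt_edist_BB v2 v3 d23 ob23) : tilt d3 < (dir d3 - dir d2) / 2 by lra.
  by rewrite /shrinkage; lra.
have /le_cost : perm_eq
    (vertices [:: (endB d1, endA d2); (endB d2, endB d3); (endA d3, endA d1)])
    [:: endA d1; endB d1; endA d2; endB d2; endA d3; endB d3].
  by apply/permP => P /=; ring.
rewrite /pairing_cost !big_cons big_nil /= addr0.
have := lt_edist_BA v1 v2 d12 ob12 h12; have := le_edist_BB v2 v3 d23 h23.
have := le_edist_AA v3 v1' d31 h31; rewrite endA_turn.
rewrite -[wA (turn d1)]/(wA d1) /shrinkage /=.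
by lra.
Qed.

End Improve.

Lemma ccw_turn d1 d2 : ccw d1 d2 -> ccw (turn d1) (turn d2).
Proof. by rewrite /ccw /= opprD addrACA subrr addr0. Qed.

(** If an inequality of the cyclic exchange fails, a rotation of the triple makes it the one between
    the first two diameters. *)
Lemma not_max_triple d1 d2 d3 : valid d1 -> valid d2 -> valid d3 ->
  ccw d1 d2 -> ccw d2 d3 -> ccw d3 (turn d1) ->
  (k = 1 -> oblique d1 \/ oblique d2) -> (k = 1 -> oblique d2 \/ oblique d3) ->
  (k = 1 -> oblique d3 \/ oblique d1) ->
  max_pairing [seq diameter_pair d | d <- [:: d1; d2; d3]] -> False.
Proof.
move=> v1 v2 v3 d12 d23 d31 ob12 ob23 ob31 max123.
have v1' : valid (turn d1) := v1; have v2' : valid (turn d2) := v2.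
have rotate d d' d'' : max_pairing [seq diameter_pair d | d <- [:: d; d'; d'']] ->
    max_pairing [seq diameter_pair d | d <- [:: d'; d''; turn d]].
  move=> maxd; apply: max_pairing_perm maxd.
    by rewrite /= /diameter_pair endA_turn endB_turn; apply/permP => P /=; ring.
  by rewrite /= /pairing_cost !big_cons !big_nil /= endA_turn endB_turn; ring.
have [h12|h12] := leP (tilt d2 - tilt d1) ((dir d2 - dir d1) / 2); last first.
  exact: (@not_max_triple_reversed d1 d2 d3).
have [h23|h23] := leP (tilt d3 - tilt d2) ((dir d3 - dir d2) / 2); last first.
  apply: (@not_max_triple_reversed d2 d3 (turn d1)) => //.
  - exact: ccw_turn.
  - exact: rotate.
have [h31|h31] := leP (tilt d1 - tilt d3) ((dir (turn d1) - dir d3) / 2); last first.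
  apply: (@not_max_triple_reversed d3 (turn d1) (turn d2)) => //.
  - exact: ccw_turn.
  - exact: ccw_turn.
  - exact/rotate/rotate.
exact: (@not_max_triple_cyclic d1 d2 d3).
Qed.

End Triple.

(** * The optimal scaling of the discs *)

Section Minimizer.
Variable R : realType.
Local Notation point := 'rV[R]_2.
Local Open Scope classical_set_scope.

Lemma edist_continuous (c : point) : continuous (fun x : point => edist x c).
Proof.
move=> x; rewrite /edist.
have -> : (fun y : point => enorm (y - c)) =
    Num.sqrt \o (fun y : point => (y 0 0 - c 0 0) ^+ 2 + (y 0 1 - c 0 1) ^+ 2).
  by apply/funext => y; rewrite /= enormE !mxE.
apply: continuous_comp; last exact: sqrt_continuous.
have coord i : {for x, continuous (fun y : point => (y 0 i - c 0 i) ^+ 2)}.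
  apply: (@continuous_comp _ _ _ (fun y : point => y 0 i - c 0 i) (fun z : R => z ^+ 2)).
    by apply: (@continuousB _ R _ (fun y : point => y 0 i) (fun=> c 0 i));
      [exact: coord_continuous|exact: cst_continuous].
  exact: exprn_continuous.
exact: (continuousD (coord 0) (coord 1)).
Qed.

Lemma coord_le_edist (x c : point) i : `|x 0 i - c 0 i| <= edist x c.
Proof.
rewrite /edist /enorm -sqrtr_sqr ler_wsqrtr// (bigD1 i)//= !mxE lerDl.
by apply: sumr_ge0 => j _; exact: sqr_ge0.
Qed.

(** The largest ratio [F] of distance to radius is continuous and exceeds [F 0] outside a compact
    box, so it attains a minimum. *)
Lemma exists_min_scale (s : seq (point * R)) : s != [::] ->
  (forall p, p \in s -> 0 < p.2) ->
  exists o t, (forall p, p \in s -> edist o p.1 <= t * p.2) /\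
    (forall x, exists2 p, p \in s & t * p.2 <= edist x p.1).
Proof.
move=> s0 s_gt0.
pose F x := \big[Num.max/0]_(p <- s) (edist x p.1 / p.2).
have Fge x p : p \in s -> edist x p.1 <= F x * p.2.
  move=> ps; rewrite -ler_pdivrMr ?s_gt0//.
  by rewrite /F; apply: (@le_bigmax_seq _ _ _ _ _ p xpredT (fun q => edist x q.1 / q.2)).
have Fle x : exists2 p, p \in s & F x * p.2 <= edist x p.1.
  suff [p ps Fp] : exists2 p, p \in s & F x <= edist x p.1 / p.2.
    by exists p => //; rewrite -ler_pdivlMr ?s_gt0.
  rewrite /F; move: s0 s_gt0; clear F Fge; elim: s => // p s IHs _ s_gt0.
  have p0 : 0 <= edist x p.1 / p.2.
    by rewrite divr_ge0 ?sqrtr_ge0// ltW// s_gt0 ?mem_head.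
  have [->|s0] := eqVneq s [::].
    by exists p; rewrite ?mem_head// big_cons big_nil ge_max lexx.
  have [|q qs Fq] := IHs s0; first by move=> q qs; rewrite s_gt0// inE qs orbT.
  rewrite big_cons; have [pq|pq] := leP (edist x q.1 / q.2) (edist x p.1 / p.2).
    by exists p; rewrite ?mem_head// ge_max lexx (le_trans Fq).
  by exists q; rewrite ?inE ?qs ?orbT// ge_max Fq ltW.
have Fcont : continuous F.
  rewrite /F; clear; elim: s => [|p s IHs].
    by under eq_fun do rewrite big_nil; exact: cst_continuous.
  under eq_fun do rewrite big_cons.
  move=> x; apply: (@continuous_max _ _ (fun y : point => edist y p.1 / p.2)
    (fun y => \big[Num.max/0]_(q <- s) (edist y q.1 / q.2))); last exact: IHs.
  apply: (@continuousM _ _ (fun y : point => edist y p.1) (fun=> p.2^-1)).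
    exact: edist_continuous.
  exact: cst_continuous.
have [p ps] : exists p, p \in s by case: s s0 {s_gt0 F Fge Fle Fcont} => // p s; exists p; rewrite mem_head.
(* If [F x < F 0], then [x] is within [F 0 * p.2] of [p.1], which bounds both coordinates by [N]. *)
pose N := F 0 * p.2 + `|p.1 0 0| + `|p.1 0 1|.
pose K : set point := [set x | forall i, `[- N, N]%classic (x ord0 i)].
have Kcompact : compact K.
  by apply: (@rV_compact R 2 (fun=> `[- N, N]%classic)) => i; exact: segment_compact.
have F0 : 0 <= F 0 by rewrite /F; exact: bigmax_ge_id.
have N0 : 0 <= N by rewrite !addr_ge0// mulr_ge0// ltW// s_gt0.
have K0 : K 0 by move=> i /=; rewrite in_itv /= mxE oppr_le0 N0.
have [|o Ko omin] := @EVT_min_rV R 2 F K (ex_intro _ 0 K0) Kcompact.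
  exact: continuous_subspaceT.
have {}omin x : F o <= F x.
  have [/mem_set/omin//|nK] := pselect (K x).
  apply: le_trans (omin 0 (mem_set K0)) _; rewrite leNgt; apply/negP => Fx.
  apply: nK => i /=; rewrite in_itv /= -ler_norml.
  have := coord_le_edist x p.1 i; have := Fge x p ps.
  have : F x * p.2 <= F 0 * p.2 by rewrite ler_wpM2r ?ltW// s_gt0.
  have : `|p.1 0 i| <= `|p.1 0 0| + `|p.1 0 1|.
    by case: (ord2P i) => ->; rewrite ?lerDl ?lerDr.
  have := ler_normD (x 0 i - p.1 0 i) (p.1 0 i); rewrite subrK /N; lra.
exists o, (F o); split => [q qs|x]; first exact: Fge.
have [q qs Fq] := Fle x; exists q => //; apply: le_trans Fq.
by rewrite ler_wpM2r// ltW// s_gt0.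
Qed.

End Minimizer.

(** * Vectors in the plane contained in no open half-plane *)

Section Stationary.
Variable R : realType.
Local Notation point := 'rV[R]_2.
Implicit Types (u v w : point).

Lemma edist_decreasing (o c d : point) (M : R) :
  edist o c <= M -> (edist o c = M -> 0 < dot d (c - o)) ->
  exists2 e : R, 0 < e & forall eps : R, 0 < eps < e -> edist (o + eps *: d) c < M.
Proof.
rewrite le_eqVlt => /orP[/eqP ocM /(_ ocM) dc|ocM _].
  have d1 : 0 < enorm d ^+ 2 + 1 by rewrite ltr_wpDl ?sqr_ge0.
  (* The squared distance changes by [- 2 eps (d . (c - o)) + eps^2 |d|^2], negative for such [eps];
     the added 1 keeps the denominator positive. *)
  exists (dot d (c - o) / (enorm d ^+ 2 + 1)); first exact: divr_gt0.
  move=> eps /andP[eps0]; rewrite ltr_pdivlMr// => epsd.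
  have M0 : 0 <= M by rewrite -ocM sqrtr_ge0.
  rewrite -(ltr_pXn2r (n := 2)) ?nnegrE ?enorm_ge0// -ocM.
  move: dc epsd; rewrite /edist !sqr_enorm /dot !mxE => dc epsd.
  rewrite -subr_gt0 in epsd; have := mulr_gt0 eps0 epsd.
  by have := mulr_gt0 eps0 dc; have := mulr_gt0 eps0 eps0; lra.
have d1 : 0 < enorm d + 1 by rewrite ltr_wpDl ?enorm_ge0.
exists ((M - edist o c) / (enorm d + 1)); first by rewrite divr_gt0 ?subr_gt0.
move=> eps /andP[eps0]; rewrite ltr_pdivlMr// => epsd.
rewrite /edist addrAC; apply: le_lt_trans (enormD _ _) _.
by rewrite enormZ gtr0_norm//; move: epsd; rewrite /edist; nra.
Qed.

(** A small step along such a [d] would bring all distances below their bounds at once, since the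
    list is finite. *)
Lemma min_scale_stationary (s : seq (point * R)) (o : point) (t : R) :
  (forall p, p \in s -> edist o p.1 <= t * p.2) ->
  (forall x, exists2 p, p \in s & t * p.2 <= edist x p.1) ->
  ~ exists d, forall p, p \in s -> edist o p.1 = t * p.2 -> 0 < dot d (p.1 - o).
Proof.
move=> le_t ge_t [d d_gt0].
have [e e0 decr] : exists2 e : R, 0 < e & forall (eps : R) p, 0 < eps < e -> p \in s ->
    edist (o + eps *: d) p.1 < t * p.2.
  elim: s le_t d_gt0 {ge_t} => [|p s IHs] le_t d_gt0; first by exists 1.
  have [||e e0 decr] := IHs.
  - by move=> q qs; apply: le_t; rewrite inE qs orbT.
  - by move=> q qs; apply: d_gt0; rewrite inE qs orbT.
  have [e' e'0 decr'] := edist_decreasing (le_t _ (mem_head _ _)) (d_gt0 _ (mem_head _ _)).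
  exists (Num.min e e'); first by rewrite lt_min e0.
  move=> eps q /andP[eps0]; rewrite lt_min => /andP[epse epse'].
  by rewrite inE => /orP[/eqP ->|qs]; [apply: decr'|apply: decr]; rewrite ?eps0.
have [p ps] := ge_t (o + (e / 2) *: d).
by rewrite leNgt decr//; lra.
Qed.

(** The vectors lie in the cone swept counterclockwise from [l] to [r] through less than [pi],
    possibly a single ray. *)
Definition half_plane_cone (s : seq point) l r :=
  (0 < cross l r \/ cross l r = 0 /\ 0 < dot l r) /\
  forall v, v \in s -> exists2 ab : R * R,
    (0 <= ab.1) && (0 <= ab.2) && (0 < ab.1 + ab.2) & v = ab.1 *: l + ab.2 *: r.

(** The bisector [enorm r *: l + enorm l *: r] makes acute angles with [l] and [r], hence with the
    whole cone. *)
Lemma half_plane_cone_dot (s : seq point) l r : half_plane_cone s l r ->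
  exists d, forall v, v \in s -> 0 < dot d v.
Proof.
move=> [lr sP].
have lrE := sqr_dot_cross l r.
have l0 := enorm_ge0 l; have r0 := enorm_ge0 r; have lr0 := mulr_ge0 l0 r0.
have lr_gt0 : 0 < enorm l * enorm r + dot l r.
  by case: lr => [c|[c d]]; nra.
have [l1 r1] : 0 < enorm l /\ 0 < enorm r.
  have : enorm l * enorm r != 0 by apply/eqP => z; case: lr => [c|[c d]]; nra.
  by rewrite mulf_eq0 negb_or !lt_def l0 r0 !andbT => /andP.
exists (enorm r *: l + enorm l *: r) => v /sP[[a b] /= /andP[/andP[a0 b0] ab] ->].
have dl : dot (enorm r *: l + enorm l *: r) l = enorm l * (enorm l * enorm r + dot l r).
  have := sqr_enorm l; rewrite /dot !mxE => E.
  rewrite mulrDr [X in _ = X + _]mulrA -expr2 E; ring.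
have dr : dot (enorm r *: l + enorm l *: r) r = enorm r * (enorm l * enorm r + dot l r).
  have := sqr_enorm r; rewrite /dot !mxE => E.
  rewrite mulrDr [X in _ = X + _]mulrC -mulrA -expr2 E; ring.
set d := _ *: l + _ in dl dr *.
have -> : dot d (a *: l + b *: r) = a * dot d l + b * dot d r.
  by rewrite /dot !mxE; ring.
have dl0 : 0 < dot d l by rewrite dl mulr_gt0.
have dr0 : 0 < dot d r by rewrite dr mulr_gt0.
have := mulr_ge0 a0 (ltW dl0); have := mulr_ge0 b0 (ltW dr0).
have [a1|a1] := ltP 0 a; first by have := mulr_gt0 a1 dl0; lra.
have b1 : 0 < b by lra.
by have := mulr_gt0 b1 dr0; lra.
Qed.

Lemma cross_comb u v w :
  cross u v *: w = cross w v *: u + cross u w *: v.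
Proof. by apply: rV2P; rewrite !mxE /cross; ring. Qed.

Lemma cone_basis u v w : 0 < cross u v -> 0 <= cross w v -> 0 <= cross u w ->
  w != 0 -> exists2 ab : R * R,
    (0 <= ab.1) && (0 <= ab.2) && (0 < ab.1 + ab.2) & w = ab.1 *: u + ab.2 *: v.
Proof.
move=> uv wv uw w0; exists (cross w v / cross u v, cross u w / cross u v) => /=.
  have uv0 := ltW uv; rewrite !divr_ge0//= -mulrDl divr_gt0//.
  rewrite lt_def addr_ge0// andbT.
  apply: contra w0 => /eqP z; have [wv0 uw0] : cross w v = 0 /\ cross u w = 0.
    by split; lra.
  have := cross_comb u v w; rewrite wv0 uw0 !scale0r addr0 => /eqP.
  by rewrite scaler_eq0 (negPf (lt0r_neq0 uv)).
have := cross_comb u v w => E; rewrite ![_ / _]mulrC -!scalerA -scalerDr -E.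
by rewrite scalerA mulVf ?scale1r// lt0r_neq0.
Qed.

Lemma scale_parallel u v : cross u v = 0 -> u != 0 ->
  v = (dot u v / enorm u ^+ 2) *: u.
Proof.
move=> uv u0; have n0 : enorm u ^+ 2 != 0 by rewrite expf_neq0// lt0r_neq0 ?enorm_gt0.
apply: (scalerI n0); rewrite scalerA mulrC divfK//.
move: uv; rewrite sqr_enorm /dot /cross => uv.
apply: rV2P; rewrite !mxE; apply/eqP; rewrite -subr_eq0; apply/eqP.
  by transitivity (- u 0 1 * (u 0 0 * v 0 1 - u 0 1 * v 0 0));
    [ring|rewrite uv mulr0].
by transitivity (u 0 0 * (u 0 0 * v 0 1 - u 0 1 * v 0 0));
  [ring|rewrite uv mulr0].
Qed.

Definition balanced (s : seq point) :=
  (exists u v, [/\ u \in s, v \in s, cross u v = 0 & dot u v < 0]) \/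
  exists u v w, [/\ u \in s, v \in s & w \in s] /\
    [/\ 0 < cross u v, 0 < cross v w & 0 < cross w u].

Lemma crossC u v : cross v u = - cross u v.
Proof. by rewrite /cross; ring. Qed.

(** The new vector lies in the cone, widens it on one side, or is balanced by [l] and [r]. As [l]
    and [r] belong to [s], so do the witnesses of balance. *)
Lemma half_plane_cone_cons (s : seq point) w l r :
  w != 0 -> {subset [:: l; r] <= s} -> half_plane_cone s l r ->
  balanced (w :: s) \/
  exists l' r', {subset [:: l'; r'] <= w :: s} /\ half_plane_cone (w :: s) l' r'.
Proof.
move=> w0 lrs [lr sP].
have ls : l \in w :: s by rewrite inE lrs ?orbT// mem_head.
have rs : r \in w :: s by rewrite inE lrs ?orbT// !inE eqxx orbT.
have ws : w \in w :: s by rewrite mem_head.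
have sub2 x y : x \in w :: s -> y \in w :: s -> {subset [:: x; y] <= w :: s}.
  by move=> xs ys z; rewrite !inE => /orP[] /eqP ->; rewrite -in_cons.
have cone l' r' : (0 < cross l' r' \/ cross l' r' = 0 /\ 0 < dot l' r') ->
    (forall v, v \in [:: w; l; r] -> exists2 ab : R * R,
    (0 <= ab.1) && (0 <= ab.2) && (0 < ab.1 + ab.2) & v = ab.1 *: l' + ab.2 *: r') ->
    half_plane_cone (w :: s) l' r'.
  move=> l'r' gen; split => // v; rewrite inE => /orP[/eqP ->|vs].
    by apply: gen; rewrite mem_head.
  have [[a b] /= /andP[/andP[a0 b0] ab] ->] := sP v vs.
  have [|[a1 b1] /= /andP[/andP[a10 b10] ab1] lE] := gen l; first by rewrite !inE eqxx orbT.
  have [|[a2 b2] /= /andP[/andP[a20 b20] ab2] rE] := gen r; first by rewrite !inE eqxx !orbT.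
  exists (a * a1 + b * a2, a * b1 + b * b2) => /=; last first.
    by rewrite lE rE !scalerDr !scalerDl !scalerA addrACA.
  rewrite !addr_ge0 ?mulr_ge0//=.
  have := mulr_ge0 a0 (ltW ab1); have := mulr_ge0 b0 (ltW ab2).
  have [a'|a'] := ltP 0 a; first by have := mulr_gt0 a' ab1; lra.
  have b' : 0 < b by lra.
  by have := mulr_gt0 b' ab2; lra.
have nz u v : 0 < cross u v -> u != 0 /\ v != 0.
  move=> uv; split; apply/eqP => z; move: uv; rewrite z /cross !mxE;
  by rewrite ?mul0r ?mulr0 subrr ltxx.
have self l' r' : exists2 ab : R * R,
    (0 <= ab.1) && (0 <= ab.2) && (0 < ab.1 + ab.2) & l' = ab.1 *: l' + ab.2 *: r'.
  by exists (1, 0); rewrite /= ?scale1r ?scale0r ?addr0 ?lexx ?ltr01 ?ler01.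
have self' l' r' : exists2 ab : R * R,
    (0 <= ab.1) && (0 <= ab.2) && (0 < ab.1 + ab.2) & r' = ab.1 *: l' + ab.2 *: r'.
  by exists (0, 1); rewrite /= ?scale1r ?scale0r ?add0r ?lexx ?ltr01 ?ler01.
case: lr => [lr|[lr dlr]].
  have [l0 r0] := nz _ _ lr.
  (* In order: [w] in the cone opposite to the open cone; clockwise of [l] or opposite to [r];
     counterclockwise of [r] or opposite to [l]; inside the cone. *)
  have [lw|lw] := ltP (cross l w) 0; have [wr|wr] := ltP (cross w r) 0.
  - left; right; exists l, r, w; split => //; split => //;
    by rewrite crossC oppr_gt0.
  - have [wr0|wr0] := eqVneq (cross w r) 0.
      left; left; exists r, w; split => //; first by rewrite crossC wr0 oppr0.
      have rw0 : cross r w = 0 by rewrite crossC wr0 oppr0.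
      have wE := scale_parallel rw0 r0; rewrite wE /cross !mxE in lw.
      have := enorm_gt0 r0; move: (enorm r) lw => n lw n0.
      rewrite ltNge; apply/negP => dot0.
      have k0 : 0 <= dot r w / n ^+ 2 by rewrite divr_ge0 ?sqr_ge0.
      by have := mulr_ge0 k0 (ltW lr); rewrite /cross; lra.
    have {wr0}wr : 0 < cross w r by rewrite lt_def wr0.
    right; exists w, r; split; first exact: sub2.
    apply: cone; first by left.
    move=> v; rewrite !inE => /or3P[] /eqP ->; [exact: self| |exact: self'].
    by apply: cone_basis => //; [exact: ltW|rewrite crossC oppr_ge0 ltW].
  - have [lw0|lw0] := eqVneq (cross l w) 0.
      left; left; exists l, w; split => //.
      have wE := scale_parallel lw0 l0; rewrite wE /cross !mxE in wr.
      have := enorm_gt0 l0; move: (enorm l) wr => n wr n0.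
      rewrite ltNge; apply/negP => dot0.
      have k0 : 0 <= dot l w / n ^+ 2 by rewrite divr_ge0 ?sqr_ge0.
      by have := mulr_ge0 k0 (ltW lr); rewrite /cross; lra.
    have {lw0}lw : 0 < cross l w by rewrite lt_def lw0.
    right; exists l, w; split; first exact: sub2.
    apply: cone; first by left.
    move=> v; rewrite !inE => /or3P[] /eqP ->; [exact: self'|exact: self|].
    by apply: cone_basis => //; [rewrite crossC oppr_ge0 ltW|exact: ltW].
  - right; exists l, r; split; first exact: sub2.
    apply: cone; first by left.
    move=> v; rewrite !inE => /or3P[] /eqP ->; [|exact: self|exact: self'].
    exact: cone_basis.
(* The cone is a ray: [w] opens it on either side, extends it, or is opposite to [l]. *)
have l0 : l != 0 by apply/eqP => z; move: dlr; rewrite z /dot !mxE; lra.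
have ll0 : 0 < enorm l ^+ 2 by rewrite exprn_gt0// enorm_gt0.
have rE := scale_parallel lr l0; have kr := divr_gt0 dlr ll0.
have [lw|lw|lw] := ltgtP (cross l w) 0.
- right; exists w, l; split; first exact: sub2.
  apply: cone; first by left; rewrite crossC oppr_gt0.
  move=> v; rewrite !inE => /or3P[] /eqP ->; [exact: self|exact: self'|].
  exists (0, dot l r / enorm l ^+ 2); last by rewrite /= scale0r add0r.
  by rewrite /= lexx add0r kr ltW.
- right; exists l, w; split; first exact: sub2.
  apply: cone; first by left.
  move=> v; rewrite !inE => /or3P[] /eqP ->; [exact: self'|exact: self|].
  exists (dot l r / enorm l ^+ 2, 0); last by rewrite /= scale0r addr0.
  by rewrite /= lexx addr0 kr ltW.
- have wE := scale_parallel lw l0.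
  have [dlw|dlw|dlw] := ltgtP (dot l w) 0.
  + by left; left; exists l, w.
  + right; exists l, r; split; first exact: sub2.
    apply: cone; first by right.
    move=> v; rewrite !inE => /or3P[] /eqP ->; [|exact: self|exact: self'].
    exists (dot l w / enorm l ^+ 2, 0); last by rewrite /= scale0r addr0.
    by have kw := divr_gt0 dlw ll0; rewrite /= lexx addr0 kw ltW.
  + by move: w0; rewrite wE dlw mul0r scale0r eqxx.
Qed.

Lemma balanced_cons (s : seq point) w : balanced s -> balanced (w :: s).
Proof.
move=> [[u [v [us vs uv0 uv]]]|[u [v [z [[us vs zs] uvz]]]]].
  by left; exists u, v; rewrite !inE us vs !orbT.
by right; exists u, v, z; rewrite !inE us vs zs !orbT.
Qed.

Lemma half_plane_or_balanced (s : seq point) : (forall v, v \in s -> v != 0) ->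
  (exists d, forall v, v \in s -> 0 < dot d v) \/ balanced s.
Proof.
case: s => [|v0 s] s_neq0; first by left; exists 0.
suff [|[l [r [_ /half_plane_cone_dot]]]] : balanced (v0 :: s) \/ exists l r,
    {subset [:: l; r] <= v0 :: s} /\ half_plane_cone (v0 :: s) l r.
- by right.
- by left.
elim: s v0 s_neq0 => [|v s IHs] v0 s_neq0.
  right; exists v0, v0; split.
    by move=> x; rewrite !inE orbb.
  split.
    right; split; first by rewrite /cross; ring.
    have -> : dot v0 v0 = enorm v0 ^+ 2 by rewrite sqr_enorm /dot; ring.
    by rewrite exprn_gt0// enorm_gt0// s_neq0// mem_head.
  move=> x; rewrite inE => /eqP ->; exists (1, 0).
    by rewrite /= lexx addr0 ltr01 ler01.
  by rewrite /= scale1r scale0r addr0.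
have [||[l [r [lrs cone]]]] := IHs v.
- by move=> x xs; apply: s_neq0; rewrite inE xs orbT.
- by move=> /balanced_cons ?; left.
exact: half_plane_cone_cons (s_neq0 _ (mem_head _ _)) lrs cone.
Qed.

End Stationary.

(** * Common point of the discs *)

Section Assembly.
Variable R : realType.
Local Notation point := 'rV[R]_2.
Implicit Types (u v w : point) (p q : point * point).

Definition center p : point := 2^-1 *: (p.1 + p.2).
Definition pair_radius p : R := edist p.1 p.2 / 2.

(** Equality in the triangle inequality forces equality in Cauchy-Schwarz of each summand with the
    sum. *)
Lemma enormD_eq_cross u v : enorm u + enorm v <= enorm (u + v) ->
  cross u (u + v) = 0 /\ cross v (u + v) = 0.
Proof.
move=> uv; have := sqr_dot_cross u (u + v); have := sqr_dot_cross v (u + v).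
have := dot_le_enorm u (u + v); have := dot_le_enorm v (u + v).
have : dot u (u + v) + dot v (u + v) = enorm (u + v) ^+ 2.
  by rewrite sqr_enorm /dot !mxE; ring.
have := enorm_ge0 (u + v); have := enorm_ge0 u; have := enorm_ge0 v.
have := ler_wpM2r (enorm_ge0 (u + v)) uv.
move: (enorm (u + v)) (enorm u) (enorm v) => n a b.
move: (dot u _) (dot v _) (cross u _) (cross v _) => du dv cu cv.
move=> h b0 a0 n0 dE dv_le du_le Ev Eu.
have duE : du = a * n by nra.
have dvE : dv = b * n by nra.
by rewrite duE in Eu; rewrite dvE in Ev; split; nra.
Qed.

Lemma parallel_eq_norm u v :
  cross u v = 0 -> enorm u = enorm v -> u = v \/ u = - v.
Proof.
move=> uv nuv; have := sqr_dot_cross u v; rewrite uv nuv => /eqP.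
rewrite expr0n addr0 -subr_eq0 subr_sqr mulf_eq0 => /orP[] /eqP E; [left|right].
  apply/eqP; rewrite -subr_eq0; apply/eqP/enorm_eq0.
  have := sqr_enorm (u - v); have := sqr_enorm u; have := sqr_enorm v.
  rewrite !mxE nuv; move: E; rewrite /dot => E Ev Eu Euv.
  have := enorm_ge0 (u - v); nra.
apply/eqP; rewrite -addr_eq0; apply/eqP/enorm_eq0.
have := sqr_enorm (u + v); have := sqr_enorm u; have := sqr_enorm v.
rewrite !mxE nuv; move: E; rewrite /dot => E Ev Eu Euv.
have := enorm_ge0 (u + v); nra.
Qed.

Lemma endpoints_from_center p (o : point) : p.1 - o = center p - o + 2^-1 *: (p.1 - p.2) /\
  p.2 - o = center p - o - 2^-1 *: (p.1 - p.2).
Proof.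
by split; apply: rV2P; rewrite /center !mxE; field.
Qed.

(** Half the edge and the vector from [o] to the center are parallel of equal length, so one
    endpoint coincides with [o]. *)
Lemma radial_pair_mem p (o : point) :
  cross (p.1 - p.2) (center p - o) = 0 ->
  edist o (center p) = pair_radius p -> o \in [:: p.1; p.2].
Proof.
move=> par ocr; have [E1 E2] := endpoints_from_center p o.
have [||E|E] := @parallel_eq_norm (2^-1 *: (p.1 - p.2)) (center p - o).
- by move: par; rewrite /cross !mxE => E; lra.
- by rewrite enormZ gtr0_norm ?invr_gt0// -(enormN (_ - o)) opprB -/(edist o _) ocr mulrC.
- by rewrite E subrr in E2; move/eqP: E2; rewrite subr_eq0 !inE eq_sym orbC => ->.
- rewrite E subrr in E1.
  by move/eqP: E1; rewrite subr_eq0 !inE eq_sym => ->.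
Qed.

Lemma enorm_opposite u v :
  cross u v = 0 -> dot u v < 0 -> enorm (u - v) = enorm u + enorm v.
Proof.
move=> uv duv; have := sqr_dot_cross u v; rewrite uv expr0n addr0 => E.
have u0 := enorm_ge0 u; have v0 := enorm_ge0 v; have n0 := mulr_ge0 u0 v0.
have dE : dot u v = - (enorm u * enorm v) by nra.
apply/eqP; rewrite -(eqrXn2 (n := 2)) ?enorm_ge0 ?addr_ge0//; apply/eqP.
rewrite sqrrD !sqr_enorm !mxE -[enorm u * enorm v]opprK -dE /dot; ring.
Qed.

Lemma parallel_opposite u v w : cross u v = 0 -> dot u v < 0 ->
  cross w (u - v) = 0 -> cross w u = 0.
Proof.
move=> uv duv; have u0 : u != 0.
  by apply/eqP => z; move: duv; rewrite z /dot !mxE; lra.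
have n0 : 0 < enorm u ^+ 2 by rewrite exprn_gt0// enorm_gt0.
rewrite (scale_parallel uv u0); set k := _ / _.
have k0 : k < 0 by rewrite pmulr_llt0// invr_gt0.
rewrite /cross !mxE => E; apply: (mulfI (x := 1 - k)); first by apply/eqP; lra.
by rewrite mulr0 -E; ring.
Qed.

(** Either exchange costs at least [2 t] times the sum of the radii, so maximality forces [t = 1]
    and equality in both triangle inequalities. Both edges are then parallel to the line of centers
    and share the endpoint [o], against disjointness. *)
Lemma not_max_opposite (s : seq (point * point)) p q (o : point) (t : R) :
  uniq (vertices s) -> max_pairing s -> p \in s -> q \in s -> p != q -> 1 <= t ->
  edist o (center p) = t * pair_radius p ->
  edist o (center q) = t * pair_radius q ->
  cross (center p - o) (center q - o) = 0 ->
  dot (center p - o) (center q - o) < 0 -> False.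
Proof.
move=> us maxs ps qs pq t1 op oq cr dt.
have maxpq : max_pairing [:: p; q].
  apply: max_pairing_sub maxs; rewrite /= ?inE ?pq ?uniq_vertices_uniq//.
  by move=> z; rewrite !inE => /orP[] /eqP ->.
have rp : 0 < pair_radius p.
  by rewrite divr_gt0// enorm_gt0// subr_eq0 (uniq_vertices_pair us).
have rq : 0 < pair_radius q.
  by rewrite divr_gt0// enorm_gt0// subr_eq0 (uniq_vertices_pair us).
pose u := center p - o; pose v := center q - o.
have nuv : enorm (u - v) = t * pair_radius p + t * pair_radius q.
  rewrite enorm_opposite// -op -oq /edist /u /v.
  by rewrite -(enormN (_ - center p)) -(enormN (_ - center q)) !opprB.
have le_cost a b : perm_eq [:: p.1; a; p.2; b] [:: p.1; p.2; q.1; q.2] ->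
    edist p.1 a + edist p.2 b <= pair_radius p *+ 2 + pair_radius q *+ 2.
  move=> /(maxpq [:: (p.1, a); (p.2, b)]).
  by rewrite /pairing_cost !big_cons !big_nil /= !addr0 /pair_radius; lra.
have perm1 : perm_eq [:: p.1; q.1; p.2; q.2] [:: p.1; p.2; q.1; q.2].
  by apply/permP => P /=; ring.
have perm2 : perm_eq [:: p.1; q.2; p.2; q.1] [:: p.1; p.2; q.1; q.2].
  by apply/permP => P /=; ring.
have E1 : (p.1 - q.1) + (p.2 - q.2) = 2 *: (u - v).
  by apply: rV2P; rewrite /u /v /center !mxE; field.
have E2 : (p.1 - q.2) + (p.2 - q.1) = 2 *: (u - v).
  by apply: rV2P; rewrite /u /v /center !mxE; field.
have nW : enorm (2 *: (u - v)) = 2 * (t * pair_radius p + t * pair_radius q).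
  by rewrite enormZ nuv gtr0_norm.
have le1 := le_cost _ _ perm1; have le2 := le_cost _ _ perm2.
have tE : t = 1.
  have := enormD (p.1 - q.1) (p.2 - q.2); rewrite E1 nW => le.
  by apply/eqP; rewrite eq_le t1 andbT; move: le1; rewrite /edist; nra.
rewrite tE !mul1r in op oq nW.
have [] := @enormD_eq_cross (p.1 - q.1) (p.2 - q.2).
  by rewrite E1 nW; move: le1; rewrite /edist; lra.
have [] := @enormD_eq_cross (p.1 - q.2) (p.2 - q.1).
  by rewrite E2 nW; move: le2; rewrite /edist; lra.
rewrite E1 E2 => c1 c2 c3 c4.
have par w : cross w (2 *: (u - v)) = 0 -> cross w (u - v) = 0.
  by rewrite /cross !mxE; lra.
have cp : cross (p.1 - p.2) (u - v) = 0.
  by apply: par; move: c2 c3; rewrite /cross !mxE; lra.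
have cq : cross (q.1 - q.2) (u - v) = 0.
  by apply: par; move: c1 c3; rewrite /cross !mxE; lra.
have op' := radial_pair_mem (parallel_opposite cr dt cp) op.
have oq' : o \in [:: q.1; q.2].
  apply: radial_pair_mem oq; apply: (@parallel_opposite v u).
  - by rewrite crossC cr oppr0.
  - by move: dt; rewrite /dot; lra.
  - by move: cq; rewrite /cross !mxE; lra.
by move/eqP: pq; apply; exact: vertices_disjoint us ps qs op' oq'.
Qed.

Lemma cross_polar (r1 r2 psi1 psi2 : R) :
  cross (polar r1 psi1) (polar r2 psi2) = r1 * r2 * sin (psi2 - psi1).
Proof. by rewrite /cross !polar0 !polar1 sinB; ring. Qed.

Lemma polar_ccw (psi r : R) v : 0 < r -> 0 < cross (polar r psi) v ->
  exists2 psi', 0 < psi' - psi < pi & v = polar (enorm v) psi'.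
Proof.
move=> r0 cv; have cv1 : 0 < cross (polar 1 psi) v.
  move: cv; rewrite /cross !polar0 !polar1 !mul1r -!mulrA -mulrBr.
  by rewrite pmulr_rgt0.
have [kappa /andP[k0 kpi]] := polarP psi v; rewrite (ltW cv1) => vE.
exists (psi + kappa) => //; rewrite [psi + _]addrC addrK.
have sk : sin kappa != 0.
  apply/eqP => sk; move: cv1; rewrite vE cross_polar [psi + _]addrC addrK sk.
  by rewrite mulr0 ltxx.
rewrite !lt_def k0 kpi !andbT; apply/andP; split; apply: contraNneq sk => E.
  by rewrite E sin0.
by rewrite -E sinpi.
Qed.

Definition swap p : point * point := (p.2, p.1).

Lemma exists_diameter (o : point) (k psi : R) p : 0 < k ->
  edist o (center p) = k^-1 * pair_radius p ->
  center p - o = polar (edist o (center p)) psi ->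
  exists2 phi, 0 <= phi <= pi / 2 &
    let d := Diameter (edist o (center p)) psi phi in
    diameter_pair o k d = p \/ diameter_pair o k d = swap p.
Proof.
move=> k0 ocr cE; set rho := edist o (center p) in ocr cE *.
pose E := 2^-1 *: (p.1 - p.2).
have nE : enorm E = k * rho.
  rewrite ocr mulrA divff ?lt0r_neq0// mul1r enormZ gtr0_norm ?invr_gt0//.
  by rewrite /pair_radius mulrC.
have p1E : p.1 = o + (polar rho psi + E).
  by rewrite -cE; apply: rV2P; rewrite /E /center !mxE; field.
have p2E : p.2 = o + (polar rho psi - E).
  by rewrite -cE; apply: rV2P; rewrite /E /center !mxE; field.
have [kappa /andP[kappa0 kappapi]] := polarP psi E; rewrite nE; case: ifP => _ EE.
  (* Here [E] points counterclockwise of [psi], so A is the end at [- E], in direction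
     [psi - (pi - kappa)]. *)
  exists ((pi - kappa) / 2); first by apply/andP; split; lra.
  right; rewrite /diameter_pair /swap /endA /endB /= endpointN /endpoint.
  have -> : polar (k * rho) (psi - (pi - kappa) / 2 *+ 2) = - E.
    by rewrite EE -polarDpi -(polarD2pi _ (psi - _)); congr polar; field.
  by rewrite opprK -p1E -p2E.
exists (kappa / 2); first by apply/andP; split; lra.
left; rewrite /diameter_pair /endA /endB /= endpointN /endpoint.
have -> : polar (k * rho) (psi - kappa / 2 *+ 2) = E.
  by rewrite [RHS]EE; congr polar; field.
by rewrite -p1E -p2E; case: (p).
Qed.

Lemma not_oblique_origin (o : point) (d : diameter R) :
  ~~ oblique d -> o \in [:: endA o 1 d; endB o 1 d].
Proof.
rewrite negbK mulf_eq0 => deg.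
rewrite /endA /endB !endpoint1 cosBpihalf.
have polar00 theta : polar 0 theta = 0 :> point.
  by apply: rV2P; rewrite ?polar0 ?polar1 mul0r mxE.
by case/orP: deg => /eqP ->; rewrite mulr0 polar00 addr0 !inE eqxx ?orbT.
Qed.

Lemma max_pairing_swap p1 p2 p3 q1 q2 q3 :
  q1 = p1 \/ q1 = swap p1 -> q2 = p2 \/ q2 = swap p2 -> q3 = p3 \/ q3 = swap p3 ->
  max_pairing [:: p1; p2; p3] -> max_pairing [:: q1; q2; q3].
Proof.
move=> e1 e2 e3; apply: max_pairing_perm.
  by case: e1 e2 e3 => -> [] -> [] ->; apply/permP => P /=; ring.
rewrite /pairing_cost !big_cons !big_nil /=.
by case: e1 e2 e3 => -> [] -> [] ->; rewrite /= ?(edistC _ p1.1) ?(edistC _ p2.1) ?(edistC _ p3.1).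
Qed.

Lemma mem_swap p q (x : point) : q = p \/ q = swap p ->
  x \in [:: q.1; q.2] -> x \in [:: p.1; p.2].
Proof. by case=> ->; rewrite !inE //= orbC. Qed.

Lemma not_max_surrounding (s : seq (point * point)) p1 p2 p3 (o : point) (t : R) :
  uniq (vertices s) -> max_pairing s ->
  p1 \in s -> p2 \in s -> p3 \in s -> 1 <= t ->
  (forall p, p \in [:: p1; p2; p3] -> edist o (center p) = t * pair_radius p) ->
  0 < cross (center p1 - o) (center p2 - o) ->
  0 < cross (center p2 - o) (center p3 - o) ->
  0 < cross (center p3 - o) (center p1 - o) -> False.
Proof.
move=> us maxs p1s p2s p3s t1 oc c12 c23 c31.
have t0 : 0 < t by exact: lt_le_trans ltr01 t1.
have cross_self u : cross u u = 0 by rewrite /cross; ring.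
have p12 : p1 != p2 by apply: contraTneq c12 => ->; rewrite cross_self ltxx.
have p23 : p2 != p3 by apply: contraTneq c23 => ->; rewrite cross_self ltxx.
have p31 : p3 != p1 by apply: contraTneq c31 => ->; rewrite cross_self ltxx.
have max123 : max_pairing [:: p1; p2; p3].
  apply: max_pairing_sub maxs; rewrite /= ?inE ?negb_or ?p12 ?p23 1?eq_sym ?p31 ?uniq_vertices_uniq//.
  by move=> z; rewrite !inE => /or3P[] /eqP ->.
have n_edist p : enorm (center p - o) = edist o (center p).
  by rewrite -enormN opprB.
have rho_gt0 p : p \in s -> p \in [:: p1; p2; p3] -> 0 < edist o (center p).
  move=> ps /oc ->; rewrite mulr_gt0// divr_gt0// enorm_gt0// subr_eq0.
  exact: uniq_vertices_pair us ps.
have r1 : 0 < edist o (center p1) by rewrite rho_gt0// !inE eqxx ?orbT.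
have r2 : 0 < edist o (center p2) by rewrite rho_gt0// !inE eqxx ?orbT.
have r3 : 0 < edist o (center p3) by rewrite rho_gt0// !inE eqxx ?orbT.
have [psi1 c1E] : exists psi1, center p1 - o = polar (edist o (center p1)) psi1.
  by have [kappa _] := polarP 0 (center p1 - o); rewrite n_edist; eexists; eassumption.
have [psi2 d12 c2E] : exists2 psi2, 0 < psi2 - psi1 < pi &
    center p2 - o = polar (edist o (center p2)) psi2.
  by rewrite -n_edist; apply: polar_ccw r1 _; rewrite -c1E.
have [psi3 d23 c3E] : exists2 psi3, 0 < psi3 - psi2 < pi &
    center p3 - o = polar (edist o (center p3)) psi3.
  by rewrite -n_edist; apply: polar_ccw r2 _; rewrite -c2E.
(* The angle from [psi1] to [psi3] is below [2 pi], and a positive sine on the way back puts it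
   beyond [pi]. *)
have d31 : 0 < psi1 + pi *+ 2 - psi3 < pi.
  move: c31; rewrite c3E c1E cross_polar pmulr_rgt0 ?mulr_gt0// => s31.
  apply/andP; split; first by lra.
  rewrite ltNge; apply/negP => pi_le.
  have : 0 <= sin (psi1 + pi *+ 2 - psi3 - pi) by apply: sin_ge0_pi; apply/andP; split; lra.
  rewrite (_ : _ - pi = psi1 - psi3 + pi); last by ring.
  by rewrite sinDpi; lra.
have k0 : 0 < t^-1 by rewrite invr_gt0.
have ocV p : p \in [:: p1; p2; p3] -> edist o (center p) = t^-1^-1 * pair_radius p.
  by rewrite invrK; exact: oc.
have [|phi1 t1pi e1] := exists_diameter k0 (ocV p1 _) c1E; first by rewrite !inE eqxx.
have [|phi2 t2pi e2] := exists_diameter k0 (ocV p2 _) c2E.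
  by rewrite !inE eqxx orbT.
have [|phi3 t3pi e3] := exists_diameter k0 (ocV p3 _) c3E.
  by rewrite !inE eqxx !orbT.
set d1 := Diameter _ _ _ in e1; set d2 := Diameter _ _ _ in e2.
set d3 := Diameter _ _ _ in e3.
(* For [t = 1] nothing is stretched, so two diameters that are not oblique would share the vertex
   [o]. *)
have obl p q d d' : p \in s -> q \in s -> p != q ->
    diameter_pair o t^-1 d = p \/ diameter_pair o t^-1 d = swap p ->
    diameter_pair o t^-1 d' = q \/ diameter_pair o t^-1 d' = swap q ->
    t^-1 = 1 -> oblique d \/ oblique d'.
  move=> ps qs pq dp dq tE; rewrite tE in dp dq; apply/orP; apply: contraT.
  rewrite negb_or => /andP[/(not_oblique_origin o) od /(not_oblique_origin o) od'].
  by move: pq; rewrite (vertices_disjoint us ps qs (mem_swap dp od) (mem_swap dq od')) eqxx.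
apply: (@not_max_triple R o t^-1 _ d1 d2 d3) => //.
- by rewrite k0 invf_le1.
- exact: obl e1 e2.
- exact: obl e2 e3.
- exact: obl e3 e1.
- exact: max_pairing_swap e1 e2 e3 max123.
Qed.

Lemma max_pairing_discs (s : seq (point * point)) :
  uniq (vertices s) -> max_pairing s ->
  exists x, forall p, p \in s -> edist x (center p) < pair_radius p.
Proof.
move=> us maxs; have [->|s0] := eqVneq s [::]; first by exists 0.
pose discs := [seq (center p, pair_radius p) | p <- s].
have [||o [t [le_t ge_t]]] := @exists_min_scale R discs.
- by rewrite /discs; case: (s) s0.
- move=> _ /mapP[p ps ->] /=; rewrite divr_gt0// enorm_gt0// subr_eq0.
  exact: uniq_vertices_pair us ps.
have [t1|t1] := ltP t 1.
  exists o => p ps; have := le_t _ (map_f _ ps); rewrite /= => /le_lt_trans; apply.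
  rewrite gtr_pMl// divr_gt0// enorm_gt0// subr_eq0.
  exact: uniq_vertices_pair us ps.
have nod := min_scale_stationary le_t ge_t; exfalso.
pose active := [seq p <- s | edist o (center p) == t * pair_radius p].
have activeP p : p \in active -> p \in s /\ edist o (center p) = t * pair_radius p.
  by rewrite mem_filter => /andP[/eqP].
have [v|[d d_gt0]|bal] := @half_plane_or_balanced R [seq center p - o | p <- active].
- move=> /mapP[p /activeP[ps oc] ->]; rewrite subr_eq0; apply/eqP => cE.
  have r0 : 0 < pair_radius p.
    by rewrite divr_gt0// enorm_gt0// subr_eq0 (uniq_vertices_pair us).
  have := mulr_gt0 (lt_le_trans ltr01 t1) r0.
  by rewrite -oc cE /edist subrr enormE !mxE expr0n addr0 sqrtr0 ltxx.
- apply: nod; exists d => _ /mapP[p ps ->] /= oc; apply: d_gt0.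
  by apply: map_f; rewrite mem_filter ps oc eqxx.
case: bal => [[u [v [/mapP[p /activeP[ps op] uE] /mapP[q /activeP[qs oq] vE] uv duv]]]|].
  apply: (not_max_opposite us maxs ps qs _ t1 op oq); rewrite -?uE -?vE//.
  apply: contraTneq duv => pq; rewrite vE -pq -uE -leNgt /dot.
  by rewrite addr_ge0// -expr2 sqr_ge0.
move=> [u [v [w [[/mapP[p /activeP[ps op] ->] /mapP[q /activeP[qs oq] ->]
  /mapP[r /activeP[rs or] ->]] [uv vw wu]]]]].
apply: (not_max_surrounding us maxs ps qs rs t1 _ uv vw wu).
by move=> z; rewrite !inE => /or3P[] /eqP ->.
Qed.

End Assembly.

Theorem theorem2 (R : realType) (S : {fset 'rV[R]_2})
    (M : {fset {fset 'rV[R]_2}}) (evenS : ~~ odd #|` S|%fset)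
    (maxM : max_sum_matching S M) :
  open_tverberg_graph M.
Proof.
have [s [us maxs ->]] := max_sum_matching_pairing maxM.
have [x xP] := max_pairing_discs us maxs; exists x => a b /pairing_edgesP[p ps abE].
(* An edge determines its pair only up to order. *)
have pab : p = (a, b) \/ p = (b, a).
  have := uniq_vertices_pair us ps.
  have : p.1 \in [fset a; b]%fset by rewrite abE !inE eqxx.
  have : p.2 \in [fset a; b]%fset by rewrite abE !inE eqxx orbT.
  rewrite !inE; case: (p) => p1 p2 /= /orP[] /eqP -> /orP[] /eqP ->;
  rewrite ?eqxx// => _; by [left|right].
have := xP p ps; rewrite /open_diametral_disc /center /pair_radius /=.
by case: pab => -> //=; rewrite [b + a]addrC [edist b a]edistC.
Qed.
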